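(* Let $k\in(0,1)$. Then for all $y\in\mathbb{R}$, $$\int_{\mathbb{R}}\frac{\mathfrak{f}(x,k)}{\cosh(\pi x)}e^{2\pi i xy}\,dx=\frac{iK}{K'}\,\frac{1}{\cosh(\pi y)}\left\{\mathfrak{f}(y,k')+2y-\frac{K'}{K}\tanh(\pi y)\right\}.$$
   Context: $k\in(0,1)$, $k'=\sqrt{1-k^2}$, $K=K(k)=\int_0^{\pi/2}(1-k^2\sin^2\theta)^{-1/2}d\theta$ is the complete elliptic integral of the first kind, $K'=K(k')$, and $\tau=iK'/K$. The theta function is $\theta_4(z|\tau)=1+2\sum_{n\ge1}(-1)^ne^{\pi i\tau n^2}\cos(2nz)$, and $\theta_4'$ denotes its derivative in $z$. Define $$\mathfrak{f}(x,k):=\frac{\theta_4'(-i\pi\tau x|\tau)}{\theta_4(-i\pi\tau x|\tau)},\qquad \tau=iK'/K .$$ Replacing $k$ by $k'$ interchanges $K$ and $K'$ and replaces $\tau$ by $-1/\tau$; thus $\mathfrak{f}(y,k')=\theta_4'(i\pi y/\tau\,|-1/\tau)/\theta_4(i\pi y/\tau\,|-1/\tau)$. *)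

(* Defs.v *)
From Stdlib Require Import Reals.
From Coquelicot Require Import Coquelicot.
Open Scope R_scope.

Definition Cexp (z : C) : C :=
  (exp (Re z) * cos (Im z), exp (Re z) * sin (Im z)).

Definition Ccos (z : C) : C :=
  ((Cexp (Ci * z) + Cexp (- (Ci * z))) / 2)%C.

(* Coquelicot's total sum [Series] is real-valued; a complex series is summed
   through its real and imaginary parts. *)
Definition CSeries (a : nat -> C) : C :=
  (Series (fun n => Re (a n)), Series (fun n => Im (a n))).

(* The sum runs over n >= 1, hence the shift of the index. *)
Definition theta4 (z tau : C) : C :=
  (1 + 2 * CSeries (fun m =>
     let n := S m in
     RtoC ((-1) ^ n) * Cexp (PI * Ci * tau * RtoC (INR n ^ 2))
       * Ccos (2 * RtoC (INR n) * z)))%C.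

(* [C_derive] is total, taking its limits along a horizontal line; it is the
   complex derivative wherever that exists ([C_derive_correct]), hence
   everywhere here, as theta4 is entire in z when Im tau > 0. *)
Definition theta4' (z tau : C) : C := C_derive (fun w => theta4 w tau) z.

Definition compl_modulus (k : R) : R := sqrt (1 - k ^ 2).

Definition ellipticK (k : R) : R :=
  RInt (fun t => / sqrt (1 - k ^ 2 * sin t ^ 2)) 0 (PI / 2).

Definition ellipticK' (k : R) : R := ellipticK (compl_modulus k).

Definition tau (k : R) : C := (Ci * RtoC (ellipticK' k) / RtoC (ellipticK k))%C.

Definition frakf (x k : R) : C :=
  let z := (- Ci * PI * tau k * x)%C in
  (theta4' z (tau k) / theta4 z (tau k))%C.

(* Main.v *)
Require Import Defs.
From Stdlib Require Import Reals Lra Lia Psatz.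
From Coquelicot Require Import Coquelicot.
Open Scope R_scope.

(** Put [c = K'/K], so that [tau = i c] and [theta4] is only evaluated at the real point [PI * c * x].
    On the real line [theta4'/theta4] at [z] is [2 * sum_(n >= 1) sin (2 n z) / sinh (PI c n)]: the product
    of this sine series with [theta4] has the Fourier coefficients of [theta4'], because
    [sum_(n >= 1) (-1)^n q^(n^2) sinh (2 PI c N n) / sinh (PI c n) = - N] for [q = exp (- PI c)],
    which follows by induction on [N]. Inserting the series and the self-dual transform of [1 / cosh (PI x)]
    turns the integral into [i / cosh (PI y)] times the sum over [n >= 1] of
    [tanh (PI (y + n c)) + tanh (PI (y - n c))]. Completing this sum by the term [n = 0], multiplying by [c]
    and subtracting [2 y] gives an odd [c]-periodic function, whose Fourier sine series is [frakf y k'].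

    Both Fourier series are identified through the uniqueness of sine coefficients of continuous functions
    on [0, PI]. The two transforms needed, of [1 / cosh (PI x)] and of [1 - tanh (PI x)], come from expanding
    in powers of [exp (- 2 PI x)] and from the partial fractions of [1 / cosh] and [1 / sinh]; these in turn
    are the value at [PI / 2] and the derivative at [0] of the sine series of
    [sinh (a t) - (t / PI) sinh (a PI)]. *)

(** * Termwise continuity, integration and differentiation of series *)

(** Two exchanges of limits shape the estimates. The sine series of [frakf] has to be summed under
    an improper integral. The transform of [1 / cosh] is therefore proved on [[0, B]] with an error
    [8 * exp (- (PI * B))] that is the same for every frequency; these errors can then be summed
    against the coefficients [1 / sinh (PI c n)]. Moreover, the expansion of [fermi] in powers of
    [exp (- 2 PI x)] has no summable majorant near [x = 0], where its terms are [2, -2, 2, ...].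
    There the exact geometric remainder is integrated instead, which costs only [O (1 / N)].

    The passage from [tau] to [- 1 / tau] is a matter of periods. The periodic sum of hyperbolic
    tangents has period [c], so its frequencies are [n / c], and the transform of [1 - tanh] sampled
    there yields [1 / sinh (PI n / c)]: the same sine series with [c] inverted.

    Sine uniqueness only gives identities on an open half period; oddness and periodicity carry them
    to the whole line. *)

Ltac to_R :=
  cbv beta;
  repeat match goal with
  | |- context [@plus ?G ?a ?b] => change (@plus G a b) with (Rplus a b)
  | |- context [@minus ?G ?a ?b] => change (@minus G a b) with (Rminus a b)
  | |- context [@opp ?G ?a] => change (@opp G a) with (Ropp a)
  | |- context [@scal ?K ?V ?a ?b] => change (@scal K V a b) with (Rmult a b)
  | |- context [@mult ?K ?a ?b] => change (@mult K a b) with (Rmult a b)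
  | |- context [@zero ?G] => change (@zero G) with R0
  end;
  try match goal with |- @eq _ ?a ?b => change (@eq R a b) end.

Lemma ex_series_dominated (a M : nat -> R) :
  (forall n, Rabs (a n) <= M n) -> ex_series M -> ex_series a.
Proof.
  intros Ha HM. apply (@ex_series_le R_AbsRing R_CompleteNormedModule a M); [exact Ha | exact HM].
Qed.

Lemma is_series_Rscal (c : R) (a : nat -> R) (l : R) :
  is_series a l -> is_series (fun n => c * a n) (c * l).
Proof. intros H. exact (is_series_scal_l c a l H). Qed.

Lemma ex_series_Rscal (c : R) (a : nat -> R) : ex_series a -> ex_series (fun n => c * a n).
Proof. intros [l Hl]. exists (c * l). now apply is_series_Rscal. Qed.

Lemma series_remainder_le (a M : nat -> R) (N : nat) :
  (forall n, Rabs (a n) <= M n) -> ex_series M ->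
  Rabs (Series a - sum_n a N) <= Series M - sum_n M N.
Proof.
  intros Ha HM.
  assert (Hea : ex_series (fun n => Rabs (a n))).
  { apply (ex_series_dominated _ M); [intros n; rewrite Rabs_Rabsolu; apply Ha | exact HM]. }
  assert (HS : forall b : nat -> R, ex_series b ->
            Series b - sum_n b N = Series (fun k => b (S N + k)%nat)).
  { intros b Hb. rewrite (Series_incr_n b (S N)); [|lia|exact Hb].
    rewrite sum_n_Reals. simpl pred. ring. }
  rewrite !HS; [|exact HM|apply ex_series_Rabs, Hea].
  eapply Rle_trans; [apply Series_Rabs|].
  - apply (ex_series_incr_n (fun n => Rabs (a n)) (S N)). exact Hea.
  - apply Series_le.
    + intros k. split; [apply Rabs_pos | apply Ha].
    + apply (ex_series_incr_n M (S N)), HM.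
Qed.

Lemma series_remainder_small (M : nat -> R) (eps : R) :
  ex_series M -> 0 < eps ->
  exists N0, forall N, (N0 <= N)%nat -> Rabs (Series M - sum_n M N) < eps.
Proof.
  intros HM He.
  pose proof (Series_correct M HM) as H.
  destruct (proj1 (filterlim_locally (sum_n M) (Series M)) H (mkposreal eps He)) as [N HN].
  exists N. intros n Hn. specialize (HN n Hn).
  unfold ball in HN; simpl in HN; unfold AbsRing_ball, abs, minus, plus, opp in HN; simpl in HN.
  rewrite Rabs_minus_sym. exact HN.
Qed.

Lemma continuous_sum_n (u : nat -> R -> R) (N : nat) (x : R) :
  (forall n, continuous (u n) x) -> continuous (fun t => sum_n (fun n => u n t) N) x.
Proof.
  intros Hu. induction N as [|N IH].
  - eapply continuous_ext; [|apply (Hu 0%nat)]. intros t. now rewrite sum_O.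
  - eapply continuous_ext; [|apply (continuous_plus _ _ _ IH (Hu (S N)))].
    intros t. now rewrite sum_Sn.
Qed.

Lemma continuous_Reps (f : R -> R) (x : R) :
  continuous f x <->
  (forall eps, 0 < eps -> exists d, 0 < d /\ forall y, Rabs (y - x) < d -> Rabs (f y - f x) < eps).
Proof.
  split.
  - intros H eps He.
    destruct (proj1 (filterlim_locally f (f x)) H (mkposreal eps He)) as [d Hd].
    exists d. split; [apply cond_pos|]. intros y Hy. exact (Hd y Hy).
  - intros H. apply filterlim_locally. intros eps.
    destruct (H eps (cond_pos eps)) as [d [Hd Hy]].
    exists (mkposreal d Hd). intros y Hyx. exact (Hy y Hyx).
Qed.

(** The majorant is only asked for on [Rabs t < A]: the terms [kappa_term c y n] have no summable
    bound valid for all [y], so there [M] depends on [A]. *)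
Lemma continuous_Series (u : nat -> R -> R) (M : nat -> R) (A x : R) :
  ex_series M -> Rabs x < A ->
  (forall n t, Rabs t < A -> Rabs (u n t) <= M n) ->
  (forall n, continuous (u n) x) ->
  continuous (fun t => Series (fun n => u n t)) x.
Proof.
  intros HM Hx Hu Hc. apply continuous_Reps. intros eps He.
  destruct (series_remainder_small M (eps / 3) HM ltac:(lra)) as [N HN'].
  pose proof (HN' N (Nat.le_refl N)) as HN.
  destruct (proj1 (continuous_Reps _ _) (continuous_sum_n u N x Hc) (eps / 3) ltac:(lra))
    as [d [Hd HdN]].
  exists (Rmin d (A - Rabs x)). split; [apply Rmin_pos; lra|].
  intros y Hy.
  pose proof (Rmin_l d (A - Rabs x)); pose proof (Rmin_r d (A - Rabs x)).
  assert (Hy' : Rabs y < A).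
  { replace y with ((y - x) + x) by ring.
    pose proof (Rabs_triang (y - x) x). lra. }
  pose proof (series_remainder_le (fun n => u n y) M N (fun n => Hu n y Hy') HM).
  pose proof (series_remainder_le (fun n => u n x) M N (fun n => Hu n x Hx) HM).
  specialize (HdN y ltac:(lra)).
  pose proof (Rle_abs (Series M - sum_n M N)).
  revert H1 H2 HdN. unfold Rabs; repeat destruct Rcase_abs; lra.
Qed.

Lemma ex_RInt_cont (f : R -> R) (a b : R) : (forall x, continuous f x) -> ex_RInt f a b.
Proof. intros Hf. apply (@ex_RInt_continuous R_CompleteNormedModule). intros z _. apply Hf. Qed.

Lemma is_RInt_sum_n (u : nat -> R -> R) (I : nat -> R) (a b : R) (N : nat) :
  (forall n, is_RInt (u n) a b (I n)) ->
  is_RInt (fun t => sum_n (fun n => u n t) N) a b (sum_n I N).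
Proof.
  intros Hu. induction N as [|N IH].
  - rewrite sum_O. eapply is_RInt_ext; [|apply (Hu 0%nat)]. intros t _. now rewrite sum_O.
  - rewrite sum_Sn. eapply is_RInt_ext; [|apply (is_RInt_plus _ _ _ _ _ _ IH (Hu (S N)))].
    intros t _. now rewrite sum_Sn.
Qed.

Lemma is_RInt_close (f g : R -> R) (a b e F G : R) :
  a <= b -> (forall x, a <= x <= b -> Rabs (f x - g x) <= e) ->
  is_RInt f a b F -> is_RInt g a b G -> Rabs (F - G) <= e * (b - a).
Proof.
  intros Hab Hfg Hf Hg.
  pose proof (norm_RInt_le (fun x => f x - g x) (fun _ => e) a b (F - G) (e * (b - a)) Hab) as H.
  apply H.
  - exact Hfg.
  - apply (is_RInt_minus f g a b F G Hf Hg).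
  - replace (e * (b - a)) with (scal (b - a) e) by (unfold scal; simpl; unfold mult; simpl; ring).
    apply @is_RInt_const.
Qed.

Lemma is_series_Reps (a : nat -> R) (l : R) :
  (forall eps, 0 < eps -> exists N0, forall N, (N0 <= N)%nat -> Rabs (sum_n a N - l) < eps) ->
  is_series a l.
Proof.
  intros H. apply (proj2 (filterlim_locally (sum_n a) l)). intros eps.
  destruct (H eps (cond_pos eps)) as [N0 HN]. exists N0. intros n Hn. exact (HN n Hn).
Qed.

(** Weierstrass domination. [F] is any value of the integral of the sum, so evaluating the series on
    the left in a second way and comparing through [is_series_unique] computes that integral. *)
Lemma is_series_RInt (u : nat -> R -> R) (M I : nat -> R) (a b F : R) :
  a <= b -> ex_series M ->
  (forall n t, a <= t <= b -> Rabs (u n t) <= M n) ->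
  (forall n, is_RInt (u n) a b (I n)) ->
  is_RInt (fun t => Series (fun n => u n t)) a b F ->
  is_series I F.
Proof.
  intros Hab HM Hu HI HF. apply is_series_Reps. intros eps He.
  destruct (series_remainder_small M (eps / (b - a + 1)) HM) as [N0 HN0].
  { apply Rdiv_lt_0_compat; lra. }
  exists N0. intros N HN. specialize (HN0 N HN).
  assert (H : Rabs (F - sum_n I N) <= Rabs (Series M - sum_n M N) * (b - a)).
  { apply (is_RInt_close (fun t => Series (fun n => u n t))
             (fun t => sum_n (fun n => u n t) N)); auto.
    - intros x Hx. eapply Rle_trans; [|apply Rle_abs].
      apply (series_remainder_le (fun n => u n x)); auto.
    - apply is_RInt_sum_n, HI. }
  rewrite Rabs_minus_sym. eapply Rle_lt_trans; [exact H|].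
  set (r := Rabs (Series M - sum_n M N)) in *.
  assert (0 <= r) by apply Rabs_pos.
  apply Rle_lt_trans with (r * (b - a + 1)); [nra|].
  apply Rmult_lt_reg_r with (/ (b - a + 1)); [apply Rinv_0_lt_compat; lra|].
  rewrite Rmult_assoc, Rinv_r, Rmult_1_r; [exact HN0|lra].
Qed.

(** The series of derivatives is continuous and integrates termwise to a difference of values of the
    original series; the fundamental theorem of calculus then differentiates it back. *)
Lemma is_derive_Series (u u' : nat -> R -> R) (M : nat -> R) (t : R) :
  ex_series M -> (forall n x, Rabs (u' n x) <= M n) ->
  (forall x, ex_series (fun n => u n x)) ->
  (forall n x, is_derive (u n) x (u' n x)) ->
  (forall n x, continuous (u' n) x) ->
  is_derive (fun x => Series (fun n => u n x)) t (Series (fun n => u' n t)).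
Proof.
  intros HM Hb Hex Hd Hc.
  set (g := fun x => Series (fun n => u' n x)).
  assert (Hg : forall x, continuous g x).
  { intros x. apply (continuous_Series u' M (Rabs x + 1)); auto; lra. }
  set (U := fun x => Series (fun n => u n x)).
  (* The base point [t - 1] leaves every [x] near [t] on its right, as termwise integration wants
     ordered endpoints. *)
  assert (HU : forall x, t - 1 <= x -> is_RInt g (t - 1) x (U x - U (t - 1))).
  { intros x Hx.
    assert (HI : is_RInt g (t - 1) x (RInt g (t - 1) x)).
    { apply (@RInt_correct R_CompleteNormedModule), ex_RInt_cont, Hg. }
    assert (Hs : is_series (fun n => u n x - u n (t - 1)) (RInt g (t - 1) x)).
    { apply (is_series_RInt u' M _ (t - 1) x); auto.
      intros n. apply (is_RInt_derive (u n) (u' n)); auto. }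
    apply is_series_unique in Hs. rewrite Series_minus in Hs by auto.
    unfold U. rewrite Hs. exact HI. }
  assert (HD : is_derive (fun x => U x - U (t - 1)) t (g t)).
  { apply (is_derive_RInt g _ (t - 1)); [|apply Hg].
    exists (mkposreal 1 Rlt_0_1). intros y Hy. apply HU.
    unfold ball in Hy; simpl in Hy; unfold AbsRing_ball, abs, minus, plus, opp in Hy; simpl in Hy.
    revert Hy; unfold Rabs; destruct Rcase_abs; lra. }
  apply (is_derive_ext (fun x => (U x - U (t - 1)) + U (t - 1))).
  { intros x. unfold U; simpl. ring. }
  replace (Series (fun n => u' n t)) with (g t + 0) by (unfold g; ring).
  apply (is_derive_plus (fun x => U x - U (t - 1)) (fun _ => U (t - 1)) t (g t) 0 HD).
  apply (is_derive_const (V := R_NormedModule)).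
Qed.

(** * Uniqueness of half-range sine series *)

(** The trivial moment [m = 0] is included so that the index can be lowered by one when multiplying
    by [cos]. *)
Definition sine_orthogonal (f : R -> R) : Prop :=
  forall m : nat, is_RInt (fun t => f t * sin (INR m * t)) 0 PI 0.

Lemma sine_orthogonal_ext (f g : R -> R) :
  (forall t, f t = g t) -> sine_orthogonal f -> sine_orthogonal g.
Proof.
  intros H Hf m. eapply is_RInt_ext; [|apply (Hf m)]. intros t _. simpl. now rewrite H.
Qed.

Lemma sine_orthogonal_lin (a b : R) (f g : R -> R) :
  sine_orthogonal f -> sine_orthogonal g -> sine_orthogonal (fun t => a * f t + b * g t).
Proof.
  intros Hf Hg m.
  pose proof (is_RInt_plus _ _ _ _ _ _ (is_RInt_scal _ _ _ a _ (Hf m))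
                (is_RInt_scal _ _ _ b _ (Hg m))) as H.
  replace 0 with (plus (scal a 0) (scal b 0)) at 2
    by (unfold plus, scal; simpl; unfold mult; simpl; ring).
  eapply is_RInt_ext; [|exact H].
  intros t _. unfold plus, scal; simpl; unfold mult; simpl; ring.
Qed.

(** By [sin (m t) cos t = (sin ((m + 1) t) + sin ((m - 1) t)) / 2]. Iterating, [f] may be multiplied
    by any polynomial in [cos t], which supplies the peaked test functions for uniqueness. *)
Lemma sine_orthogonal_cos (f : R -> R) :
  sine_orthogonal f -> sine_orthogonal (fun t => f t * cos t).
Proof.
  intros Hf [|m].
  - eapply is_RInt_ext; [|apply (Hf 0%nat)].
    intros t _. simpl. rewrite Rmult_0_l, sin_0. ring.
  - pose proof (is_RInt_plus _ _ _ _ _ _ (is_RInt_scal _ _ _ (/2) _ (Hf (S (S m))))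
                  (is_RInt_scal _ _ _ (/2) _ (Hf m))) as H.
    replace 0 with (plus (scal (/2) 0) (scal (/2) 0)) at 2
      by (unfold plus, scal; simpl; unfold mult; simpl; ring).
    eapply is_RInt_ext; [|exact H].
    intros t _. rewrite !S_INR. unfold plus, scal; simpl; unfold mult; simpl.
    replace ((INR m + 1 + 1) * t) with ((INR m + 1) * t + t) by ring.
    replace (INR m * t) with ((INR m + 1) * t - t) by ring.
    rewrite sin_plus, sin_minus. field.
Qed.

Lemma sine_orthogonal_pow (a b c : R) (f : R -> R) (n : nat) :
  sine_orthogonal f ->
  sine_orthogonal (fun t => f t * (a + b * cos t + c * (cos t * cos t)) ^ n).
Proof.
  intros Hf. induction n as [|n IH].
  - apply (sine_orthogonal_ext f); [intros t; simpl; ring | exact Hf].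
  - pose proof (sine_orthogonal_cos _ IH) as H1.
    pose proof (sine_orthogonal_cos _ H1) as H2.
    pose proof (sine_orthogonal_lin 1 c _ _ (sine_orthogonal_lin a b _ _ IH H1) H2) as H.
    eapply sine_orthogonal_ext; [|exact H]. intros t. simpl. ring.
Qed.

(* The powers of the trigonometric polynomial [P] blow up near [x0] and stay bounded elsewhere. *)
Lemma sine_orthogonal_not_pos (f : R -> R) (x0 : R) :
  (forall x, continuous f x) -> sine_orthogonal f -> 0 < x0 < PI -> 0 < f x0 -> False.
Proof.
  intros Hc Hf Hx0 Hpos.
  (* The moment [m = 1] of [f] times a polynomial in [cos] is the integral of [e] times that
     polynomial, and [sin] is positive inside the interval, so [e] has the sign of [f]. *)
  set (e := fun t => f t * sin t).
  assert (Hs0 : 0 < sin x0) by (apply sin_gt_0; lra).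
  assert (Hce : forall x, continuous e x).
  { intros x. apply (continuous_mult f sin); [apply Hc|].
    apply continuity_pt_filterlim, continuity_sin. }
  assert (He0 : 0 < e x0) by (unfold e; nra).
  set (eta := e x0 / 2).
  destruct (proj1 (continuous_Reps e x0) (Hce x0) eta ltac:(unfold eta; lra)) as [d [Hd He]].
  set (d' := Rmin d (Rmin x0 (PI - x0)) / 2).
  assert (Hd' : 0 < d' /\ d' < d /\ d' < x0 /\ d' < PI - x0).
  { assert (0 < Rmin d (Rmin x0 (PI - x0))) by (repeat apply Rmin_pos; lra).
    pose proof (Rmin_l d (Rmin x0 (PI - x0))). pose proof (Rmin_r d (Rmin x0 (PI - x0))).
    pose proof (Rmin_l x0 (PI - x0)). pose proof (Rmin_r x0 (PI - x0)).
    unfold d'. repeat split; lra. }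
  assert (Hcos1 : cos x0 < cos (x0 - d')) by (apply cos_decreasing_1; lra).
  assert (Hcos2 : cos (x0 + d') < cos x0) by (apply cos_decreasing_1; lra).
  set (r := Rmin (cos (x0 - d') - cos x0) (cos x0 - cos (x0 + d'))).
  assert (Hr : 0 < r) by (apply Rmin_pos; lra).
  assert (Hr2 : r <= cos (x0 - d') - cos x0 /\ r <= cos x0 - cos (x0 + d')).
  { split; [apply Rmin_l | apply Rmin_r]. }
  assert (Hclose : forall t, 0 <= t <= PI -> Rabs (cos t - cos x0) < r -> eta < e t).
  { intros t Ht Hct. apply Rabs_def2 in Hct.
    assert (Rabs (t - x0) < d).
    { apply Rabs_def1.
      - destruct (Rlt_le_dec t (x0 + d')); [lra|].
        assert (cos t <= cos (x0 + d')).
        { destruct (Req_dec t (x0 + d')) as [->|]; [lra|].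
          left; apply cos_decreasing_1; lra. }
        lra.
      - destruct (Rlt_le_dec (x0 - d') t); [lra|].
        assert (cos (x0 - d') <= cos t).
        { destruct (Req_dec t (x0 - d')) as [->|]; [lra|].
          left; apply cos_decreasing_1; lra. }
        lra. }
    specialize (He t H). apply Rabs_def2 in He. unfold eta in *. lra. }
  (* With this [rho], [P t > 1] exactly when [Rabs (cos t - cos x0) < r]. Since two cosines differ
     by at most 2, the divisor 4 keeps [P] positive, so its powers do not oscillate in sign. *)
  set (rho := r * r / 4).
  set (P := fun t => 1 + rho - cos x0 * cos x0 / 4 + cos x0 / 2 * cos t
                     + - (1 / 4) * (cos t * cos t)).
  assert (HP : forall t, P t = 1 + rho - (cos t - cos x0) * (cos t - cos x0) / 4).
  { intros t. unfold P. field. }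
  assert (Hrho : 0 < rho) by (unfold rho; nra).
  assert (HcP : forall x, continuous P x).
  { intros x. apply continuity_pt_filterlim. unfold P. reg. }
  assert (HeP : forall n a b, ex_RInt (fun t => e t * P t ^ n) a b).
  { intros n a b. apply ex_RInt_cont. intros x.
    apply (continuous_mult e (fun t => P t ^ n)); [apply Hce|].
    apply (continuous_comp P (fun u => u ^ n)); [apply HcP|].
    apply continuity_pt_filterlim. reg. }
  assert (H0 : forall n, RInt (fun t => e t * P t ^ n) 0 PI = 0).
  { intros n. apply is_RInt_unique.
    eapply is_RInt_ext; [|apply (sine_orthogonal_pow (1 + rho - cos x0 * cos x0 / 4)
      (cos x0 / 2) (- (1 / 4)) f n Hf 1%nat)].
    intros t _. unfold e, P. simpl (INR 1). rewrite Rmult_1_l. simpl. ring. }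
  destruct (continuity_ab_maj (fun t => Rabs (e t)) 0 PI) as [xM [HM _]].
  { pose proof PI_RGT_0; lra. }
  { intros c _. apply continuity_pt_filterlim.
    apply (continuous_comp e Rabs); [apply Hce | apply continuous_Rabs]. }
  set (M := Rabs (e xM)) in *.
  assert (HM0 : 0 <= M) by apply Rabs_pos.
  destruct (proj1 (continuous_Reps cos x0)
     (proj1 (continuity_pt_filterlim _ _) (continuity_cos x0)) (r / 2) ltac:(lra))
    as [d2 [Hd2 Hcd2]].
  set (d3 := Rmin d2 d' / 2).
  assert (Hd3 : 0 < d3 /\ d3 < d2 /\ d3 < d').
  { assert (0 < Rmin d2 d') by (apply Rmin_pos; lra).
    pose proof (Rmin_l d2 d'). pose proof (Rmin_r d2 d'). unfold d3. repeat split; lra. }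
  assert (Hlow : forall n t, 0 <= t <= PI -> - M <= e t * P t ^ n).
  { intros n t Ht.
    destruct (Rlt_le_dec (Rabs (cos t - cos x0)) r) as [Hlt|Hge].
    - pose proof (Hclose t Ht Hlt).
      assert (0 <= P t ^ n).
      { apply pow_le. rewrite HP. apply Rabs_def2 in Hlt. unfold rho. nra. }
      unfold eta in *. nra.
    - assert (0 <= P t ^ n <= 1).
      { assert (0 <= P t <= 1).
        { rewrite HP. pose proof (COS_bound t). pose proof (COS_bound x0). split.
          - nra.
          - assert (r * r <= (cos t - cos x0) * (cos t - cos x0)).
            { revert Hge. unfold Rabs; destruct Rcase_abs; intros; nra. }
            unfold rho; lra. }
        split; [apply pow_le; lra|]. rewrite <- (pow1 n). apply pow_incr. exact H. }
      specialize (HM t Ht). pose proof (Rabs_def2 (e t) (M + 1)).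
      assert (- M <= e t).
      { revert HM. unfold Rabs at 1; destruct Rcase_abs; lra. }
      nra. }
  (* Here the cosines differ by less than [r / 2], so [P t] exceeds
     [1 + r^2 / 4 - r^2 / 16 = 1 + 3 * rho / 4]. *)
  assert (Hhigh : forall n t, x0 - d3 <= t <= x0 + d3 ->
            eta * (1 + 3 * rho / 4) ^ n <= e t * P t ^ n).
  { intros n t Ht.
    assert (Hct : Rabs (cos t - cos x0) < r / 2).
    { apply Hcd2. apply Rabs_def1; lra. }
    assert (eta < e t) by (apply Hclose; lra).
    assert ((1 + 3 * rho / 4) ^ n <= P t ^ n).
    { apply pow_incr. rewrite HP. apply Rabs_def2 in Hct. unfold rho. nra. }
    assert (0 <= (1 + 3 * rho / 4) ^ n) by (apply pow_le; lra).
    assert (0 < eta) by (unfold eta; lra).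
    nra. }
  (* The whole integral is zero and the two outer pieces lose at most [M] per unit length, so the
     middle piece stays bounded in [n], against its geometric growth. *)
  assert (Hint : forall n, (2 * d3) * (eta * (1 + 3 * rho / 4) ^ n) <= M * PI).
  { intros n.
    assert (Hlb : forall a b c, a <= b -> (forall t, a < t < b -> c <= e t * P t ^ n) ->
              (b - a) * c <= RInt (fun t => e t * P t ^ n) a b).
    { intros a b c Hab Hc'.
      replace ((b - a) * c) with (RInt (fun _ => c) a b)
        by (rewrite RInt_const; reflexivity).
      apply RInt_le; [exact Hab | apply ex_RInt_const | apply HeP | exact Hc']. }
    pose proof (H0 n) as Hz.
    rewrite <- (RInt_Chasles _ 0 (x0 - d3) PI) in Hz by apply HeP.
    rewrite <- (RInt_Chasles _ (x0 - d3) (x0 + d3) PI) in Hz by apply HeP.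
    unfold plus in Hz; simpl in Hz.
    pose proof (Hlb 0 (x0 - d3) (- M) ltac:(lra) ltac:(intros; apply Hlow; lra)) as A1.
    pose proof (Hlb (x0 - d3) (x0 + d3) _ ltac:(lra) ltac:(intros; apply Hhigh; lra)) as A2.
    pose proof (Hlb (x0 + d3) PI (- M) ltac:(lra) ltac:(intros; apply Hlow; lra)) as A3.
    assert (0 <= d3 * M) by nra.
    nra. }
  assert (Heta : 0 < eta) by (unfold eta; lra).
  assert (Hk : 0 < 2 * d3 * eta * (3 * rho / 4)).
  { apply Rmult_lt_0_compat; [apply Rmult_lt_0_compat|]; lra. }
  destruct (INR_unbounded (M * PI / (2 * d3 * eta * (3 * rho / 4)))) as [n Hn].
  specialize (Hint n).
  (* Bernoulli's inequality [1 + n x <= (1 + x)^n]; linear growth already contradicts the bound. *)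
  pose proof (poly n (3 * rho / 4) ltac:(lra)) as Hp.
  assert (M * PI < INR n * (2 * d3 * eta * (3 * rho / 4))).
  { apply Rmult_lt_reg_r with (/ (2 * d3 * eta * (3 * rho / 4))).
    - now apply Rinv_0_lt_compat.
    - rewrite (Rmult_assoc (INR n)), Rinv_r, Rmult_1_r; [exact Hn | lra]. }
  assert (0 < 2 * d3 * eta) by (apply Rmult_lt_0_compat; lra).
  nra.
Qed.

Lemma sine_orthogonal_zero (f : R -> R) (x : R) :
  (forall x, continuous f x) -> sine_orthogonal f -> 0 < x < PI -> f x = 0.
Proof.
  intros Hc Hf Hx. destruct (Rtotal_order (f x) 0) as [H|[H|H]].
  - exfalso. apply (sine_orthogonal_not_pos (fun t => -1 * f t + 0 * f t) x); auto.
    + intros z. apply (continuous_ext (fun t => - f t)).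
      { intros t; simpl; ring. }
      apply (continuous_opp f), Hc.
    + now apply sine_orthogonal_lin.
    + lra.
  - exact H.
  - exfalso. now apply (sine_orthogonal_not_pos f x).
Qed.

Lemma sin_INR_PI (k : nat) : sin (INR k * PI) = 0.
Proof. apply sin_eq_0_1. exists (Z.of_nat k). now rewrite INR_IZR_INZ. Qed.

Lemma sine_orthogonality (m n : nat) :
  is_RInt (fun t => sin (INR (S m) * t) * sin (INR n * t)) 0 PI
    (if Nat.eq_dec (S m) n then PI / 2 else 0).
Proof.
  destruct (Nat.eq_dec (S m) n) as [<-|Hne].
  - assert (Hk : INR (S m) <> 0) by (apply not_0_INR; lia).
    set (k := INR (S m)) in *.
    replace (PI / 2) with ((PI / 2 - sin (2 * k * PI) / (4 * k)) - (0 / 2 - sin (2 * k * 0) / (4 * k))).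
    2:{ replace (2 * k * PI) with (0 + 2 * k * PI) by ring. unfold k at 1.
        rewrite sin_period, Rmult_0_r, sin_0. field. exact Hk. }
    apply (is_RInt_derive (fun t => t / 2 - sin (2 * k * t) / (4 * k))).
    + intros t _. auto_derive; [exact I|].
      replace (2 * k * t) with (2 * (k * t)) by ring. rewrite cos_2a_sin. field. exact Hk.
    + intros t _. apply continuity_pt_filterlim. reg.
  - set (k := INR (S m)). set (l := INR n).
    assert (H1 : k - l <> 0).
    { unfold k, l. intros H. apply Hne, INR_eq. lra. }
    assert (H2 : k + l <> 0).
    { unfold k, l. pose proof (pos_INR n). rewrite S_INR. pose proof (pos_INR m). lra. }
    assert (Hm : sin ((k - l) * PI) = 0).
    { replace ((k - l) * PI) with (k * PI - l * PI) by ring.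
      rewrite sin_minus. unfold k, l. rewrite !sin_INR_PI. ring. }
    assert (Hp : sin ((k + l) * PI) = 0).
    { replace ((k + l) * PI) with (k * PI + l * PI) by ring.
      rewrite sin_plus. unfold k, l. rewrite !sin_INR_PI. ring. }
    replace 0 with ((sin ((k - l) * PI) / (2 * (k - l)) - sin ((k + l) * PI) / (2 * (k + l)))
       - (sin ((k - l) * 0) / (2 * (k - l)) - sin ((k + l) * 0) / (2 * (k + l)))) at 2.
    2:{ rewrite Hm, Hp, !Rmult_0_r, sin_0. field. auto. }
    apply (is_RInt_derive (fun t => sin ((k - l) * t) / (2 * (k - l)) - sin ((k + l) * t) / (2 * (k + l)))).
    + intros t _. auto_derive; [exact I|].
      replace ((k - l) * t) with (k * t - l * t) by ring.
      replace ((k + l) * t) with (k * t + l * t) by ring.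
      rewrite cos_minus, cos_plus. field. auto.
    + intros t _. apply continuity_pt_filterlim. reg.
Qed.

Lemma sine_series_abs_le (b : R) (n : nat) (t : R) : Rabs (b * sin (INR n * t)) <= Rabs b.
Proof.
  rewrite Rabs_mult. rewrite <- (Rmult_1_r (Rabs b)) at 2.
  apply Rmult_le_compat_l; [apply Rabs_pos|].
  apply Rabs_le, SIN_bound.
Qed.

Lemma continuous_sin_lin (k x : R) : continuous (fun t => sin (k * t)) x.
Proof. apply continuity_pt_filterlim. reg. Qed.

Lemma continuous_cos_lin (k x : R) : continuous (fun t => cos (k * t)) x.
Proof. apply continuity_pt_filterlim. reg. Qed.

Lemma continuous_sine_series (b : nat -> R) (x : R) :
  ex_series (fun n => Rabs (b n)) ->
  continuous (fun t => Series (fun n => b n * sin (INR (S n) * t))) x.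
Proof.
  intros Hb. apply (continuous_Series (fun n t => b n * sin (INR (S n) * t))
    (fun n => Rabs (b n)) (Rabs x + 1)); auto.
  - lra.
  - intros n t _. apply sine_series_abs_le.
  - intros n. apply (continuous_mult (fun _ => b n)); [apply continuous_const|].
    apply continuous_sin_lin.
Qed.

Lemma is_series_single (a : nat -> R) (k : nat) :
  (forall n, n <> k -> a n = 0) -> is_series a (a k).
Proof.
  intros H. apply is_series_Reps. intros eps He. exists k. intros N HN.
  assert (HS : sum_n a N = a k).
  { assert (forall j, (j < k)%nat -> sum_n a j = 0).
    { induction j as [|j IH]; intros Hj.
      - rewrite sum_O. apply H. lia.
      - rewrite sum_Sn, IH, H by lia. unfold plus; simpl; ring. }
    induction HN as [|N HN IH].
    - destruct k as [|k]; [now rewrite sum_O|].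
      rewrite sum_Sn, H0 by lia. unfold plus; simpl; ring.
    - rewrite sum_Sn, IH, (H (S N)) by lia. unfold plus; simpl; ring. }
  rewrite HS, Rminus_diag, Rabs_R0. exact He.
Qed.

Lemma sine_series_coeff (b : nat -> R) (k : nat) :
  ex_series (fun n => Rabs (b n)) ->
  is_RInt (fun t => Series (fun n => b n * sin (INR (S n) * t)) * sin (INR (S k) * t)) 0 PI
    (PI / 2 * b k).
Proof.
  intros Hb.
  set (g := fun t => Series (fun n => b n * sin (INR (S n) * t)) * sin (INR (S k) * t)).
  assert (HI : is_RInt g 0 PI (RInt g 0 PI)).
  { apply (@RInt_correct R_CompleteNormedModule), ex_RInt_cont. intros x.
    apply (continuous_mult (fun t => Series (fun n => b n * sin (INR (S n) * t)))).
    - now apply continuous_sine_series.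
    - apply continuous_sin_lin. }
  assert (Hs : is_series (fun n => b n * (if Nat.eq_dec (S n) (S k) then PI / 2 else 0))
                 (RInt g 0 PI)).
  { apply (is_series_RInt
      (fun n t => b n * sin (INR (S n) * t) * sin (INR (S k) * t)) (fun n => Rabs (b n)) _ 0 PI); auto.
    - pose proof PI_RGT_0; lra.
    - intros n t _. eapply Rle_trans; [apply sine_series_abs_le|apply sine_series_abs_le].
    - intros n. eapply is_RInt_ext; [|apply (is_RInt_scal _ _ _ (b n) _ (sine_orthogonality n (S k)))].
      intros t _. unfold scal; simpl; unfold mult; simpl; ring.
    - eapply is_RInt_ext; [|exact HI]. intros t _. unfold g. now rewrite <- Series_scal_r. }
  pose proof (is_series_single (fun n => b n * (if Nat.eq_dec (S n) (S k) then PI / 2 else 0)) k) as H1.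
  lapply H1; [clear H1; intros H1|].
  - apply is_series_unique in Hs. apply is_series_unique in H1. rewrite Hs in H1.
    destruct Nat.eq_dec as [_|]; [|lia].
    replace (PI / 2 * b k) with (b k * (PI / 2)) by ring. rewrite <- H1. exact HI.
  - intros n Hn. destruct Nat.eq_dec; [lia|ring].
Qed.

(** Absolute summability of [b] makes the series continuous with sine coefficients [b], so its
    difference from [f] is continuous and orthogonal to all sines. This takes the place of a
    pointwise convergence theorem for Fourier series. *)
Lemma sine_series_representation (f : R -> R) (b : nat -> R) (x : R) :
  (forall x, continuous f x) -> ex_series (fun n => Rabs (b n)) ->
  (forall k, is_RInt (fun t => f t * sin (INR (S k) * t)) 0 PI (PI / 2 * b k)) ->
  0 < x < PI -> f x = Series (fun n => b n * sin (INR (S n) * x)).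
Proof.
  intros Hc Hb Hf Hx. apply Rminus_diag_uniq.
  apply (sine_orthogonal_zero (fun x => f x - Series (fun n => b n * sin (INR (S n) * x))) x); auto.
  - intros z. apply (continuous_minus f); [apply Hc | now apply continuous_sine_series].
  - intros [|k].
    + apply (is_RInt_ext (fun _ => 0)).
      { intros t _. simpl. rewrite Rmult_0_l, sin_0. ring. }
      pose proof (is_RInt_const (V := R_NormedModule) 0 PI 0) as H.
      unfold scal in H; simpl in H; unfold mult in H; simpl in H.
      now rewrite Rmult_0_r in H.
    + replace 0 with (minus (PI / 2 * b k) (PI / 2 * b k)) at 2
        by (unfold minus, plus, opp; simpl; ring).
      eapply is_RInt_ext; [|apply (is_RInt_minus _ _ _ _ _ _ (Hf k) (sine_series_coeff b k Hb))].
      intros t _. unfold minus, plus, opp; simpl. ring.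
Qed.

(** * Partial fractions of 1/sinh and 1/cosh *)

(** Comparison with a telescoping series through [1 / k^2 <= 2 / (k (k + 1))]. It is the common
    majorant for the sinh, csch and theta coefficients below. *)
Lemma ex_series_inv_sqr : ex_series (fun n => / (INR (S n) * INR (S n))).
Proof.
  assert (H : is_series (fun n => / INR (S n) - / INR (S (S n))) 1).
  { assert (HS : forall N, sum_n (fun n => / INR (S n) - / INR (S (S n))) N = 1 - / INR (S (S N))).
    { induction N as [|N IH].
      - rewrite sum_O. simpl INR at 1. now rewrite Rinv_1.
      - rewrite sum_Sn, IH. to_R. ring. }
    apply is_series_Reps. intros eps He.
    destruct (INR_unbounded (/ eps)) as [N0 HN0]. exists N0. intros N HN. rewrite HS.
    assert (INR N0 < INR (S (S N))) by (apply lt_INR; lia).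
    assert (0 < / eps) by now apply Rinv_0_lt_compat.
    replace (1 - / INR (S (S N)) - 1) with (- / INR (S (S N))) by ring.
    rewrite Rabs_Ropp, Rabs_pos_eq by (left; apply Rinv_0_lt_compat; lra).
    rewrite <- (Rinv_inv eps). apply Rinv_lt_contravar; [|lra].
    apply Rmult_lt_0_compat; lra. }
  apply (ex_series_dominated _ (fun n => 2 * (/ INR (S n) - / INR (S (S n))))).
  - intros n. rewrite (S_INR (S n)). set (k := INR (S n)).
    assert (1 <= k) by (unfold k; rewrite S_INR; pose proof (pos_INR n); lra).
    rewrite Rabs_pos_eq by (left; apply Rinv_0_lt_compat; nra).
    replace (2 * (/ k - / (k + 1))) with ((2 * k) * / (k * k * (k + 1))) by (field; lra).
    replace (/ (k * k)) with ((k + 1) * / (k * k * (k + 1))) by (field; lra).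
    apply Rmult_le_compat_r; [|lra]. left; apply Rinv_0_lt_compat. nra.
  - apply (ex_series_Rscal 2). eexists; exact H.
Qed.

Lemma cos_INR_PI (k : nat) : cos (INR k * PI) = (-1) ^ k.
Proof.
  induction k as [|k IH]; [simpl; now rewrite Rmult_0_l, cos_0|].
  rewrite S_INR. replace ((INR k + 1) * PI) with (INR k * PI + PI) by ring.
  rewrite neg_cos, IH. simpl. ring.
Qed.

Lemma is_derive_sinh (x : R) : is_derive sinh x (cosh x).
Proof. apply is_derive_Reals, derivable_pt_lim_sinh. Qed.

Lemma continuous_sinh (x : R) : continuous sinh x.
Proof. apply (ex_derive_continuous (V := R_NormedModule)). eexists. apply is_derive_sinh. Qed.

Lemma sinh_pos (x : R) : 0 < x -> 0 < sinh x.
Proof. intros Hx. unfold sinh. pose proof (exp_increasing (- x) x). lra. Qed.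

Lemma cosh_pos (x : R) : 0 < cosh x.
Proof. unfold cosh. pose proof (exp_pos x). pose proof (exp_pos (- x)). lra. Qed.

Lemma sinh_opp (x : R) : sinh (- x) = - sinh x.
Proof. unfold sinh. rewrite Ropp_involutive. field. Qed.

Lemma cosh_opp (x : R) : cosh (- x) = cosh x.
Proof. unfold cosh. rewrite Ropp_involutive. field. Qed.

(** Sine coefficients of [sinh (a t) - (t / PI) sinh (a PI)]. The two parts give
    [1 / n - n / (n^2 + a^2)], merged here into one fraction to expose the cubic decay. That decay,
    due to the function vanishing at both endpoints, allows termwise differentiation. *)
Definition sinh_coeff (a : R) (n : nat) : R :=
  2 / PI * ((-1) ^ S n * sinh (a * PI) * (a * a / (INR (S n) * (INR (S n) * INR (S n) + a * a)))).

Lemma INR_S_ge1 (n : nat) : 1 <= INR (S n).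
Proof. rewrite S_INR; pose proof (pos_INR n); lra. Qed.

Lemma sinh_coeff_abs_le (a : R) (n : nat) :
  Rabs (INR (S n) * sinh_coeff a n)
  <= 2 / PI * Rabs (sinh (a * PI)) * (a * a) * / (INR (S n) * INR (S n)).
Proof.
  unfold sinh_coeff. pose proof (INR_S_ge1 n) as Hk. set (k := INR (S n)) in *.
  pose proof PI_RGT_0.
  replace (k * (2 / PI * ((-1) ^ S n * sinh (a * PI) * (a * a / (k * (k * k + a * a))))))
    with ((-1) ^ S n * (2 / PI * sinh (a * PI) * (a * a / (k * k + a * a)))) by (field; split; nra).
  rewrite Rabs_mult, pow_1_abs, Rmult_1_l, !Rabs_mult.
  assert (0 < 2 / PI) by (apply Rdiv_lt_0_compat; lra).
  rewrite (Rabs_pos_eq (2 / PI)) by lra.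
  rewrite (Rmult_assoc _ (a * a)).
  apply Rmult_le_compat_l.
  - pose proof (Rabs_pos (sinh (a * PI))). nra.
  - assert (0 < k * k + a * a) by nra.
    rewrite Rabs_pos_eq by (apply Rle_mult_inv_pos; nra).
    unfold Rdiv. apply Rmult_le_compat_l; [nra|]. apply Rinv_le_contravar; nra.
Qed.

Lemma ex_series_sinh_coeff (a : R) :
  ex_series (fun n => 2 / PI * Rabs (sinh (a * PI)) * (a * a) * / (INR (S n) * INR (S n))).
Proof.
  apply (ex_series_Rscal (2 / PI * Rabs (sinh (a * PI)) * (a * a))), ex_series_inv_sqr.
Qed.

Lemma ex_series_abs_sinh_coeff (a : R) : ex_series (fun n => Rabs (sinh_coeff a n)).
Proof.
  eapply ex_series_dominated; [|apply (ex_series_sinh_coeff a)].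
  intros n. rewrite Rabs_Rabsolu. eapply Rle_trans; [|apply sinh_coeff_abs_le].
  rewrite Rabs_mult. pose proof (INR_S_ge1 n).
  rewrite (Rabs_pos_eq (INR (S n))) by lra. pose proof (Rabs_pos (sinh_coeff a n)). nra.
Qed.

Lemma sinh_sine_coeff (a : R) (n : nat) :
  is_RInt (fun t => (sinh (a * t) - t / PI * sinh (a * PI)) * sin (INR (S n) * t)) 0 PI
    (PI / 2 * sinh_coeff a n).
Proof.
  pose proof (INR_S_ge1 n) as Hk. pose proof PI_RGT_0.
  assert (E : PI / 2 * sinh_coeff a n = (-1) ^ S n * sinh (a * PI) *
     (/ INR (S n) - INR (S n) / (INR (S n) * INR (S n) + a * a))).
  { unfold sinh_coeff. field. repeat split; nra. }
  rewrite E, <- cos_INR_PI. pose proof (sin_INR_PI (S n)) as Hs. clear E.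
  set (k := INR (S n)) in *. set (w := sinh (a * PI)).
  set (F := fun t => (a * cosh (a * t) * sin (k * t) - k * sinh (a * t) * cos (k * t)) / (k * k + a * a)
                 - w / PI * (sin (k * t) / (k * k) - t * cos (k * t) / k)).
  assert (HF : cos (k * PI) * w * (/ k - k / (k * k + a * a)) = F PI - F 0).
  { unfold F. rewrite !Rmult_0_r, Hs, sin_0, sinh_0. fold w. field. repeat split; nra. }
  rewrite HF. apply (is_RInt_derive F).
  - intros t _. unfold F. auto_derive; [repeat split; auto|].
      field. repeat split; nra.
  - intros t _. apply (continuous_mult (fun t => sinh (a * t) - t / PI * w)); [|apply continuous_sin_lin].
    apply (continuous_minus (fun t => sinh (a * t)) (fun t => t / PI * w)).
    + apply (continuous_comp (fun t => a * t) sinh); [|apply continuous_sinh].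
      apply continuity_pt_filterlim; reg.
    + apply continuity_pt_filterlim; reg.
Qed.

(** Both sides are odd, which extends the half-range identity to a full neighbourhood of 0, where it
    will be differentiated. *)
Lemma sinh_sine_series (a x : R) : - PI < x < PI ->
  sinh (a * x) - x / PI * sinh (a * PI) = Series (fun n => sinh_coeff a n * sin (INR (S n) * x)).
Proof.
  assert (Hpos : forall x, 0 < x < PI -> sinh (a * x) - x / PI * sinh (a * PI)
     = Series (fun n => sinh_coeff a n * sin (INR (S n) * x))).
  { clear x. intros x Hx.
    apply (sine_series_representation (fun x => sinh (a * x) - x / PI * sinh (a * PI)) (sinh_coeff a)).
    - intros z. apply (continuous_minus (fun t => sinh (a * t)) (fun t => t / PI * sinh (a * PI))).
      + apply (continuous_comp (fun t => a * t) sinh); [|apply continuous_sinh].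
        apply continuity_pt_filterlim; reg.
      + apply continuity_pt_filterlim; reg.
    - apply ex_series_abs_sinh_coeff.
    - apply sinh_sine_coeff.
    - exact Hx. }
  intros Hx. destruct (Rtotal_order x 0) as [H|[->|H]].
  - specialize (Hpos (- x) ltac:(lra)).
    replace (a * - x) with (- (a * x)) in Hpos by ring. rewrite sinh_opp in Hpos.
    rewrite (Series_ext _ (fun n => (-1) * (sinh_coeff a n * sin (INR (S n) * x)))) in Hpos.
    + rewrite Series_scal_l in Hpos. unfold Rdiv in *. lra.
    + intros n. replace (INR (S n) * - x) with (- (INR (S n) * x)) by ring. rewrite sin_neg. ring.
  - rewrite Rmult_0_r, sinh_0, (Series_ext _ (fun n => 0 * 0)).
    + rewrite Series_scal_l. unfold Rdiv; ring.
    + intros n. rewrite Rmult_0_r, sin_0. ring.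
  - apply Hpos; lra.
Qed.

Lemma ex_series_sine_series (b : nat -> R) (x : R) :
  ex_series (fun n => Rabs (b n)) -> ex_series (fun n => b n * sin (INR (S n) * x)).
Proof.
  intros Hb. eapply ex_series_dominated; [|exact Hb]. intros n. apply sine_series_abs_le.
Qed.

(** In the derivative at 0 every cosine equals 1, so the differentiated series is a multiple of the
    alternating sum of [a^2 / (n^2 + a^2)], while the closed form has slope
    [a - sinh (a PI) / PI]. *)
Lemma csch_partial_fractions (a : R) : 0 < a ->
  is_series (fun n => (-1) ^ n / (INR (S n) * INR (S n) + a * a))
    ((/ (a * a) - PI / (a * sinh (a * PI))) / 2).
Proof.
  intros Ha. pose proof PI_RGT_0.
  assert (Hsh : 0 < sinh (a * PI)) by (apply sinh_pos, Rmult_lt_0_compat; lra).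
  assert (Hex : ex_series (fun n => INR (S n) * sinh_coeff a n)).
  { eapply ex_series_dominated; [apply sinh_coeff_abs_le | apply ex_series_sinh_coeff]. }
  assert (HD : is_derive (fun x => Series (fun n => sinh_coeff a n * sin (INR (S n) * x))) 0
            (Series (fun n => sinh_coeff a n * (INR (S n) * cos (INR (S n) * 0))))).
  { apply (is_derive_Series (fun n x => sinh_coeff a n * sin (INR (S n) * x))
      (fun n x => sinh_coeff a n * (INR (S n) * cos (INR (S n) * x)))
      (fun n => 2 / PI * Rabs (sinh (a * PI)) * (a * a) * / (INR (S n) * INR (S n)))).
    - apply ex_series_sinh_coeff.
    - intros n x. eapply Rle_trans; [|apply sinh_coeff_abs_le].
      replace (sinh_coeff a n * (INR (S n) * cos (INR (S n) * x)))
        with ((INR (S n) * sinh_coeff a n) * cos (INR (S n) * x)) by ring.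
      rewrite Rabs_mult. rewrite <- (Rmult_1_r (Rabs (INR (S n) * sinh_coeff a n))) at 2.
      apply Rmult_le_compat_l; [apply Rabs_pos|]. apply Rabs_le, COS_bound.
    - intros x. apply ex_series_sine_series, ex_series_abs_sinh_coeff.
    - intros n x. set (k := INR (S n)). auto_derive; [exact I|ring].
    - intros n x. set (k := INR (S n)). apply continuity_pt_filterlim. reg. }
  assert (HD' : is_derive (fun x => sinh (a * x) - x / PI * sinh (a * PI)) 0 (a - sinh (a * PI) / PI)).
  { auto_derive; [exact I|]. rewrite Rmult_0_r, cosh_0. field. lra. }
  assert (E : Series (fun n => INR (S n) * sinh_coeff a n) = a - sinh (a * PI) / PI).
  { rewrite <- (is_derive_unique _ _ _ HD').
    rewrite (Series_ext _ (fun n => sinh_coeff a n * (INR (S n) * cos (INR (S n) * 0)))).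
    2:{ intros n. rewrite Rmult_0_r, cos_0. ring. }
    rewrite <- (is_derive_unique _ _ _ HD).
    apply Derive_ext_loc. exists (mkposreal PI PI_RGT_0). intros y Hy.
    symmetry. apply sinh_sine_series.
    unfold ball in Hy; simpl in Hy; unfold AbsRing_ball, abs, minus, plus, opp in Hy; simpl in Hy.
    apply Rabs_def2 in Hy. lra. }
  pose proof (Series_correct _ Hex) as HS. rewrite E in HS.
  apply (is_series_Rscal (- (PI / (2 * sinh (a * PI) * (a * a))))) in HS.
  replace (- (PI / (2 * sinh (a * PI) * (a * a))) * (a - sinh (a * PI) / PI))
    with ((/ (a * a) - PI / (a * sinh (a * PI))) / 2) in HS by (field; lra).
  eapply is_series_ext; [|exact HS].
  intros n. to_R. unfold sinh_coeff. pose proof (INR_S_ge1 n). simpl pow.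
  set (k := INR (S n)) in *. field. repeat split; nra.
Qed.

Lemma is_series_even_terms (c : nat -> R) (l : R) :
  is_series c l -> (forall j, c (S (2 * j)) = 0) -> is_series (fun j => c (2 * j)%nat) l.
Proof.
  intros Hc Hodd.
  assert (HS : forall J, sum_n (fun j => c (2 * j)%nat) J = sum_n c (2 * J)%nat).
  { induction J as [|J IH].
    - now rewrite !sum_O.
    - rewrite sum_Sn, IH. replace (2 * S J)%nat with (S (S (2 * J))) by lia.
      rewrite !sum_Sn, Hodd. to_R. ring. }
  change (is_lim_seq (sum_n (fun j => c (2 * j)%nat)) l).
  apply (is_lim_seq_ext (fun J => sum_n c (2 * J)%nat)); [intros; now rewrite HS|].
  apply (is_lim_seq_subseq (sum_n c) l (fun J => (2 * J)%nat)); [|exact Hc].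
  apply eventually_subseq. intros; lia.
Qed.

Lemma leibniz_series : is_series (fun j => (-1) ^ j * / INR (2 * j + 1)) (PI / 4).
Proof.
  apply is_series_Reals. rewrite <- Alt_PI_eq. unfold Alt_PI. destruct exist_PI as [l Hl].
  replace (4 * l / 4) with l by field. exact Hl.
Qed.

Lemma sin_odd_half_PI (j : nat) : sin (INR (S (2 * j)) * (PI / 2)) = (-1) ^ j.
Proof.
  rewrite S_INR, mult_INR. simpl (INR 2).
  replace (((1 + 1) * INR j + 1) * (PI / 2)) with (PI / 2 + INR j * PI) by field.
  rewrite sin_plus, sin_PI2, cos_PI2, cos_INR_PI. ring.
Qed.

Lemma sinh_double (x : R) : sinh (2 * x) = 2 * sinh x * cosh x.
Proof.
  unfold sinh, cosh. replace (2 * x) with (x + x) by ring.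
  rewrite Ropp_plus_distr, !exp_plus. field.
Qed.

(** At [PI / 2] only odd frequencies [m] survive, with alternating signs and terms
    [a^2 / (m (m^2 + a^2))]. Subtracting them from the Leibniz series for [PI / 4] leaves [1 / m -
    a^2 / (m (m^2 + a^2)) = m / (m^2 + a^2)]. *)
Lemma sech_partial_fractions (a : R) : 0 <= a ->
  is_series (fun j => (-1) ^ j * (INR (2 * j + 1) / (INR (2 * j + 1) * INR (2 * j + 1) + a * a)))
    (PI / (4 * cosh (a * PI / 2))).
Proof.
  intros [Ha | <-].
  (* For [a = 0] the claim is the Leibniz series itself; it is split off because the general case
     divides by [sinh (a * PI)]. *)
  2:{ replace (0 * PI / 2) with 0 by field. rewrite cosh_0, Rmult_1_r.
      eapply is_series_ext; [|apply leibniz_series].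
      intros j. simpl. field. pose proof (INR_S_ge1 (2 * j)).
      replace (S (2 * j)) with (2 * j + 1)%nat in H by lia. simpl in H. lra. }
  pose proof PI_RGT_0.
  assert (Hsh : 0 < sinh (a * PI)) by (apply sinh_pos, Rmult_lt_0_compat; lra).
  assert (Hsh2 : 0 < sinh (a * PI / 2)).
  { apply sinh_pos. pose proof (Rmult_lt_0_compat a PI). lra. }
  pose proof (cosh_pos (a * PI / 2)) as Hch.
  set (c := fun n => sinh_coeff a n * sin (INR (S n) * (PI / 2))).
  assert (Hc : is_series c (sinh (a * (PI / 2)) - PI / 2 / PI * sinh (a * PI))).
  { rewrite sinh_sine_series by lra. apply Series_correct.
    apply ex_series_sine_series, ex_series_abs_sinh_coeff. }
  apply is_series_even_terms in Hc.
  2:{ intros j. unfold c. replace (INR (S (S (2 * j))) * (PI / 2)) with (INR (S j) * PI).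
      - rewrite sin_INR_PI. ring.
      - rewrite !S_INR, mult_INR. simpl (INR 2). field. }
  apply (is_series_Rscal (- (PI / (2 * sinh (a * PI))))) in Hc.
  pose proof (is_series_minus _ _ _ _ leibniz_series Hc) as HL.
  replace (PI / (4 * cosh (a * PI / 2))) with (minus (PI / 4) (- (PI / (2 * sinh (a * PI))) *
        (sinh (a * (PI / 2)) - PI / 2 / PI * sinh (a * PI)))).
  2:{ to_R.
      replace (a * PI) with (2 * (a * PI / 2)) in Hsh |- * by field. rewrite sinh_double in Hsh |- *.
      replace (a * (PI / 2)) with (a * PI / 2) by field.
      replace (2 * (a * PI / 2) / 2) with (a * PI / 2) by field.
      field. repeat split; lra. }
  eapply is_series_ext; [|exact HL].
  intros j. to_R. unfold c, sinh_coeff. to_R.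
  rewrite sin_odd_half_PI.
  replace ((-1) ^ S (2 * j)) with (-1).
  2:{ rewrite <- tech_pow_Rmult, pow_mult. replace ((-1) ^ 2) with 1 by ring. rewrite pow1. ring. }
  pose proof (INR_S_ge1 (2 * j)). replace (2 * j + 1)%nat with (S (2 * j)) by lia.
  set (m := INR (S (2 * j))) in *. field. repeat split; nra.
Qed.

(** * Fourier transforms of 1/cosh and 1 - tanh *)

(* [fermi PI x = / cosh (PI * x)] and [fermi (2 * PI) x = 1 - tanh (PI * x)]. *)
Definition fermi (p x : R) : R := 2 * exp (- (p * x)) / (1 + exp (- (2 * PI * x))).

Definition fermi_rate (p : R) (k : nat) : R := p + 2 * PI * INR k.

Lemma continuous_fermi (p x : R) : continuous (fermi p) x.
Proof.
  apply (ex_derive_continuous (V := R_NormedModule)). unfold fermi. auto_derive.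
  pose proof (exp_pos (- (2 * PI * x))). lra.
Qed.

(** The remainder of an alternating geometric sum is explicit and bounded by the first omitted term.
    This includes [x = 0], where the infinite expansion diverges. *)
Lemma fermi_geometric (p x : R) (N : nat) : 0 <= x ->
  Rabs (fermi p x - sum_n (fun k => 2 * (-1) ^ k * exp (- (fermi_rate p k * x))) N)
  <= 2 * exp (- (fermi_rate p (S N) * x)).
Proof.
  intros Hx. set (u := exp (- (2 * PI * x))).
  assert (Hu : 0 < u) by apply exp_pos.
  assert (Hpow : forall k, exp (- (fermi_rate p k * x)) = exp (- (p * x)) * u ^ k).
  { induction k as [|k IH].
    - unfold fermi_rate. simpl. rewrite Rmult_1_r. f_equal. ring.
    - simpl pow. rewrite (Rmult_comm u), <- Rmult_assoc, <- IH. unfold u. rewrite <- exp_plus.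
      f_equal. unfold fermi_rate. rewrite S_INR. ring. }
  assert (HS : sum_n (fun k => 2 * (-1) ^ k * exp (- (fermi_rate p k * x))) N
     = 2 * exp (- (p * x)) * ((1 - (-1) ^ S N * u ^ S N) / (1 + u))).
  { induction N as [|N IH].
    - rewrite sum_O, Hpow. simpl. field. lra.
    - rewrite sum_Sn, IH, Hpow. to_R. simpl pow. field. lra. }
  rewrite HS, Hpow. unfold fermi. fold u.
  replace (2 * exp (- (p * x)) / (1 + u) - 2 * exp (- (p * x)) * ((1 - (-1) ^ S N * u ^ S N) / (1 + u)))
    with ((-1) ^ S N * (2 * (exp (- (p * x)) * u ^ S N) / (1 + u))) by (field; lra).
  rewrite Rabs_mult, pow_1_abs, Rmult_1_l.
  assert (0 < exp (- (p * x)) * u ^ S N).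
  { apply Rmult_lt_0_compat; [apply exp_pos | now apply pow_lt]. }
  rewrite Rabs_pos_eq by (apply Rle_mult_inv_pos; lra).
  rewrite <- (Rmult_1_r (2 * (exp (- (p * x)) * u ^ S N))) at 2.
  apply Rmult_le_compat_l; [lra|].
  assert (/ (1 + u) <= / 1) by (apply Rinv_le_contravar; lra). lra.
Qed.

(** For [s > 0] this is the tail integral of [exp (- s u) cos (b u + phi)] over [u >= x], hence
    minus an antiderivative. The phase [phi] treats cosine and sine transforms at once. *)
Definition fermi_primitive (s b phi x : R) : R :=
  exp (- (s * x)) * (s * cos (b * x + phi) - b * sin (b * x + phi)) / (s * s + b * b).

Lemma fermi_primitive_correct (s b phi B : R) : 0 < s ->
  is_RInt (fun x => exp (- (s * x)) * cos (b * x + phi)) 0 B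
    (fermi_primitive s b phi 0 - fermi_primitive s b phi B).
Proof.
  intros Hs.
  replace (fermi_primitive s b phi 0 - fermi_primitive s b phi B)
    with (- fermi_primitive s b phi B - - fermi_primitive s b phi 0) by ring.
  apply (is_RInt_derive (fun x => - fermi_primitive s b phi x)).
  - intros x _. unfold fermi_primitive. auto_derive; [exact I|]. field. nra.
  - intros x _. apply continuity_pt_filterlim. reg.
Qed.

(** From [s + |b| <= 2 (s^2 + b^2)] for [s >= 1]. The constant 2 does not involve [b], and this is
    where the frequency-uniform errors originate. *)
Lemma fermi_primitive_abs_le (s b phi x : R) : 1 <= s ->
  Rabs (fermi_primitive s b phi x) <= 2 * exp (- (s * x)).
Proof.
  intros Hs. unfold fermi_primitive. unfold Rdiv.
  rewrite Rmult_assoc, Rabs_mult, (Rabs_pos_eq (exp _)) by (left; apply exp_pos).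
  rewrite Rmult_comm. apply Rmult_le_compat_r; [left; apply exp_pos|].
  assert (Hq : 0 < s * s + b * b) by nra.
  rewrite Rabs_mult, (Rabs_pos_eq (/ _)) by (left; now apply Rinv_0_lt_compat).
  apply Rmult_le_reg_r with (s * s + b * b); [exact Hq|].
  rewrite Rmult_assoc, Rinv_l, Rmult_1_r by lra.
  pose proof (COS_bound (b * x + phi)). pose proof (SIN_bound (b * x + phi)).
  assert (Rabs (s * cos (b * x + phi) - b * sin (b * x + phi)) <= s + Rabs b).
  { eapply Rle_trans; [apply Rabs_triang|]. rewrite Rabs_Ropp, !Rabs_mult, (Rabs_pos_eq s) by lra.
    apply Rplus_le_compat; rewrite <- Rmult_1_r; apply Rmult_le_compat_l.
    - lra.
    - now apply Rabs_le.
    - apply Rabs_pos.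
    - now apply Rabs_le. }
  assert (Rabs b * Rabs b = b * b) by (rewrite <- Rabs_mult; apply Rabs_pos_eq; nra).
  pose proof (Rabs_pos b). set (c := Rabs b) in *.
  pose proof (Rle_0_sqr (c - 1)) as Hc. unfold Rsqr in Hc.
  assert (s <= s * s) by nra. nra.
Qed.

Lemma sum_n_geometric_half_le (N : nat) : sum_n (fun k => (1 / 2) ^ k) N <= 2 - (1 / 2) ^ N.
Proof.
  induction N as [|N IH].
  - rewrite sum_O. simpl. lra.
  - rewrite sum_Sn. to_R. simpl pow. lra.
Qed.

Lemma exp_neg_2PI_le_half (B : R) : 1 <= B -> exp (- (2 * PI * B)) <= 1 / 2.
Proof.
  intros HB. rewrite exp_Ropp. replace (1 / 2) with (/ 2) by field.
  apply Rinv_le_contravar; [lra|].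
  pose proof PI2_1. pose proof (exp_ineq1_le (2 * PI * B)). nra.
Qed.

(** [L] is the transform over the half line, as a sum of full exponential integrals. Cutting at [B]
    removes one tail per exponential, and these tails decrease geometrically. *)
Lemma fermi_transform_close (p b phi L B : R) : 1 <= p -> 1 <= B ->
  is_series (fun k => 2 * (-1) ^ k * fermi_primitive (fermi_rate p k) b phi 0) L ->
  Rabs (RInt (fun x => fermi p x * cos (b * x + phi)) 0 B - L) <= 8 * exp (- (p * B)).
Proof.
  intros Hp HB HL.
  assert (Hrate : forall k, 1 <= fermi_rate p k).
  { intros k. unfold fermi_rate. pose proof (pos_INR k). pose proof PI_RGT_0. nra. }
  set (I := RInt (fun x => fermi p x * cos (b * x + phi)) 0 B).
  assert (HI : is_RInt (fun x => fermi p x * cos (b * x + phi)) 0 B I).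
  { apply (@RInt_correct R_CompleteNormedModule), ex_RInt_cont. intros x.
    apply (continuous_mult (fermi p) (fun x => cos (b * x + phi))); [apply continuous_fermi|].
    apply continuity_pt_filterlim. reg. }
  set (T := fun k => 2 * (-1) ^ k * fermi_primitive (fermi_rate p k) b phi 0) in *.
  set (D := fun k => 2 * (-1) ^ k * fermi_primitive (fermi_rate p k) b phi B).
  assert (HN : forall N, Rabs (I - sum_n T N) <= 2 / INR (S N) + 8 * exp (- (p * B))).
  { intros N.
    set (s := fermi_rate p (S N)).
    assert (Hs : INR (S N) <= s).
    { unfold s, fermi_rate. pose proof (pos_INR (S N)). pose proof PI2_1. nra. }
    pose proof (INR_S_ge1 N) as Hk.
    assert (H1 : is_RInt (fun x => sum_n (fun k => 2 * (-1) ^ k *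
                   (exp (- (fermi_rate p k * x)) * cos (b * x + phi))) N) 0 B
                   (sum_n (fun k => T k - D k) N)).
    { apply (is_RInt_sum_n (fun k x => 2 * (-1) ^ k * (exp (- (fermi_rate p k * x)) * cos (b * x + phi)))).
      intros k. unfold T, D. rewrite <- Rmult_minus_distr_l.
      refine (is_RInt_scal (V := R_NormedModule) _ _ _ _ _ (fermi_primitive_correct _ _ _ _ _)).
      specialize (Hrate k); lra. }
    (* The remainder bound is a pure exponential, integrated by the same primitive at zero frequency
       and zero phase. *)
    assert (H2 : is_RInt (fun x => 2 * (exp (- (s * x)) * cos (0 * x + 0))) 0 B
                   (2 * (fermi_primitive s 0 0 0 - fermi_primitive s 0 0 B))).
    { refine (is_RInt_scal (V := R_NormedModule) _ _ _ _ _ (fermi_primitive_correct _ _ _ _ _)). lra. }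
    assert (H3 : Rabs (I - sum_n (fun k => T k - D k) N) <= 2 / INR (S N)).
    { eapply Rle_trans.
      - refine (norm_RInt_le (V := R_NormedModule) _ _ 0 B _ _ ltac:(lra) _
          (is_RInt_minus _ _ _ _ _ _ HI H1) H2).
        intros x Hx. change norm with Rabs. to_R.
        replace (sum_n (fun k => 2 * (-1) ^ k * (exp (- (fermi_rate p k * x)) * cos (b * x + phi))) N)
          with (sum_n (fun k => 2 * (-1) ^ k * exp (- (fermi_rate p k * x))) N * cos (b * x + phi)).
        2:{ rewrite <- (sum_n_mult_r (K := R_Ring) (cos (b * x + phi))).
            apply sum_n_ext. intros k. to_R. ring. }
        rewrite <- Rmult_minus_distr_r, Rabs_mult.
        replace (0 * x + 0) with 0 by ring. rewrite cos_0, Rmult_1_r.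
        rewrite <- (Rmult_1_r (2 * exp (- (s * x)))).
        apply Rmult_le_compat; try apply Rabs_pos.
        + apply fermi_geometric; lra.
        + apply Rabs_le, COS_bound.
      - pose proof (exp_pos (- (s * B))).
        replace (2 * (fermi_primitive s 0 0 0 - fermi_primitive s 0 0 B))
          with ((2 - 2 * exp (- (s * B))) / s).
        2:{ unfold fermi_primitive.
            rewrite !Rmult_0_l, !Rplus_0_l, cos_0, Rmult_0_r, Ropp_0, exp_0. field. lra. }
        assert (exp (- (s * B)) < 1).
        { rewrite <- exp_0. apply exp_increasing. nra. }
        unfold Rdiv. apply Rmult_le_compat; try lra.
        + left; apply Rinv_0_lt_compat; lra.
        + apply Rinv_le_contravar; lra. }
    (* The [k]-th tail is at most [2 * 2 * exp (- (p B))] times [exp (- 2 PI B)^k <= (1 / 2)^k], and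
       the geometric sum is at most 2. *)
    assert (H4 : Rabs (sum_n D N) <= 8 * exp (- (p * B))).
    { assert (Rabs (sum_n D N) <= 4 * exp (- (p * B)) * sum_n (fun k => (1 / 2) ^ k) N).
      { rewrite <- (sum_n_mult_l (K := R_Ring)).
        eapply Rle_trans; [apply (norm_sum_n_m (V := R_NormedModule) D)|].
        apply sum_n_m_le. intros k. change norm with Rabs. to_R.
        unfold D. rewrite !Rabs_mult, pow_1_abs, (Rabs_pos_eq 2), Rmult_1_r by lra.
        pose proof (fermi_primitive_abs_le (fermi_rate p k) b phi B (Hrate k)).
        assert (exp (- (fermi_rate p k * B)) <= exp (- (p * B)) * (1 / 2) ^ k).
        { replace (- (fermi_rate p k * B)) with (- (p * B) + INR k * - (2 * PI * B))
            by (unfold fermi_rate; ring).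
          rewrite exp_plus. apply Rmult_le_compat_l; [left; apply exp_pos|].
          pose proof (exp_neg_2PI_le_half B HB) as Hh. clear - Hh. induction k as [|k IH]; [simpl; rewrite Rmult_0_l, exp_0; lra|].
          rewrite S_INR, Rmult_plus_distr_r, Rmult_1_l, exp_plus. simpl pow.
          rewrite (Rmult_comm (1 / 2)).
          apply Rmult_le_compat; [left; apply exp_pos | left; apply exp_pos | exact IH | exact Hh]. }
        lra. }
      pose proof (sum_n_geometric_half_le N).
      assert (0 < (1 / 2) ^ N) by (apply pow_lt; lra).
      pose proof (exp_pos (- (p * B))). nra. }
    assert (H5 : sum_n (fun k => T k - D k) N = sum_n T N - sum_n D N).
    { clear. induction N as [|N IH]; [now rewrite !sum_O|]. rewrite !sum_Sn, IH. to_R. ring. }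
    rewrite H5 in H3. revert H3 H4. unfold Rabs; repeat destruct Rcase_abs; lra. }
  (* Now [N] tends to infinity with [B] fixed, which removes the remainder [2 / INR (S N)]. *)
  apply le_epsilon. intros eps He.
  destruct (proj1 (filterlim_locally _ _) HL (mkposreal (eps / 2) ltac:(lra))) as [N1 HN1].
  destruct (INR_unbounded (4 / eps)) as [N2 HN2].
  set (N := (N1 + N2)%nat).
  specialize (HN1 N ltac:(unfold N; lia)). change (Rabs (sum_n T N - L) < eps / 2) in HN1.
  specialize (HN N).
  assert (2 / INR (S N) < eps / 2).
  { assert (INR N2 <= INR (S N)) by (apply le_INR; unfold N; lia).
    assert (0 < 4 / eps) by (apply Rdiv_lt_0_compat; lra).
    apply Rmult_lt_reg_r with (INR (S N)); [lra|].
    replace (2 / INR (S N) * INR (S N)) with 2 by (field; lra).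
    assert (4 < INR (S N) * eps); [|lra].
    replace 4 with (4 / eps * eps) by (field; lra).
    apply Rmult_lt_compat_r; lra. }
  revert HN HN1. unfold Rabs; repeat destruct Rcase_abs; lra.
Qed.

Lemma fermi_PI (x : R) : fermi PI x = / cosh (PI * x).
Proof.
  unfold fermi, cosh. pose proof (exp_pos (PI * x)).
  replace (- (2 * PI * x)) with (- (PI * x) + - (PI * x)) by ring.
  rewrite exp_plus, exp_Ropp. field. repeat split; nra.
Qed.

Lemma fermi_2PI (x : R) : fermi (2 * PI) x = 1 - tanh (PI * x).
Proof.
  unfold fermi, tanh, sinh, cosh. pose proof (exp_pos (PI * x)).
  replace (- (2 * PI * x)) with (- (PI * x) + - (PI * x)) by ring.
  rewrite exp_plus, exp_Ropp. field. split; nra.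
Qed.

Lemma sech_cos_integral_close (xi B : R) : 1 <= B ->
  Rabs (RInt (fun x => / cosh (PI * x) * cos (2 * PI * xi * x)) 0 B - / (2 * cosh (PI * xi)))
  <= 8 * exp (- (PI * B)).
Proof.
  intros HB. pose proof PI2_1. pose proof PI_RGT_0.
  rewrite (RInt_ext _ (fun x => fermi PI x * cos (2 * PI * xi * x + 0))).
  2:{ intros x _. now rewrite fermi_PI, Rplus_0_r. }
  apply fermi_transform_close; [lra | exact HB|].
  (* The rates are [PI * (2 k + 1)] and the frequency is [2 PI xi]; dividing by [PI] gives partial
     fractions at [a = 2 |xi|], the absolute value meeting the sign condition on [a]. *)
  assert (Hc : cosh (2 * Rabs xi * PI / 2) = cosh (PI * xi)).
  { unfold Rabs; destruct Rcase_abs.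
    - rewrite <- cosh_opp. f_equal. field.
    - f_equal. field. }
  pose proof (is_series_Rscal (2 / PI) _ _
    (sech_partial_fractions (2 * Rabs xi) ltac:(pose proof (Rabs_pos xi); lra))) as HS.
  rewrite Hc in HS. pose proof (cosh_pos (PI * xi)).
  replace (2 / PI * (PI / (4 * cosh (PI * xi)))) with (/ (2 * cosh (PI * xi))) in HS by (field; lra).
  eapply is_series_ext; [|exact HS].
  intros k. unfold fermi_primitive, fermi_rate.
  replace (2 * k + 1)%nat with (S (2 * k)) by lia.
  replace (2 * Rabs xi * (2 * Rabs xi)) with (4 * (xi * xi)).
  2:{ rewrite <- (Rabs_pos_eq (xi * xi)), Rabs_mult by nra. ring. }
  rewrite S_INR, mult_INR. simpl (INR 2). pose proof (pos_INR k).
  rewrite !Rmult_0_r, Rplus_0_l, cos_0, sin_0, Ropp_0, exp_0. to_R. field. split; nra.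
Qed.

Lemma one_minus_tanh_sin_integral_close (xi B : R) : 0 < xi -> 1 <= B ->
  Rabs (RInt (fun x => (1 - tanh (PI * x)) * sin (2 * PI * xi * x)) 0 B
        - (/ xi - PI / sinh (PI * xi)) / (2 * PI))
  <= 8 * exp (- (2 * PI * B)).
Proof.
  intros Hxi HB. pose proof PI2_1. pose proof PI_RGT_0.
  (* The phase [- PI / 2] turns the cosine transform into the sine transform. *)
  rewrite (RInt_ext _ (fun x => fermi (2 * PI) x * cos (2 * PI * xi * x + - (PI / 2)))).
  2:{ intros x _. rewrite fermi_2PI. f_equal. rewrite cos_plus, cos_neg, sin_neg, cos_PI2, sin_PI2. ring. }
  apply fermi_transform_close; [lra | exact HB|].
  pose proof (is_series_Rscal (xi / PI) _ _ (csch_partial_fractions xi Hxi)) as HS.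
  assert (0 < sinh (PI * xi)) by (apply sinh_pos, Rmult_lt_0_compat; lra).
  replace (xi * PI) with (PI * xi) in HS by ring.
  replace (xi / PI * ((/ (xi * xi) - PI / (xi * sinh (PI * xi))) / 2))
    with ((/ xi - PI / sinh (PI * xi)) / (2 * PI)) in HS by (field; lra).
  eapply is_series_ext; [|exact HS].
  intros k. unfold fermi_primitive, fermi_rate.
  rewrite S_INR. pose proof (pos_INR k).
  rewrite !Rmult_0_r, Rplus_0_l, cos_neg, sin_neg, cos_PI2, sin_PI2, Ropp_0, exp_0. to_R. field.
  repeat split; nra.
Qed.

(** * The periodic sum of hyperbolic tangents *)

(** The points 0 and [T / 2], missing from the open half period, are forced by symmetry:
    [d (T / 2) = d (- T / 2) = - d (T / 2)]. *)
Lemma odd_periodic_zero (d : R -> R) (T : R) : 0 < T ->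
  (forall x, d (- x) = - d x) -> (forall x, d (x + T) = d x) ->
  (forall x, 0 < x < T / 2 -> d x = 0) -> forall x, d x = 0.
Proof.
  intros HT Hodd Hper Hd.
  assert (H0 : d 0 = 0) by (pose proof (Hodd 0) as H; rewrite Ropp_0 in H; lra).
  assert (H2 : d (T / 2) = 0).
  { pose proof (Hper (- (T / 2))) as H. replace (- (T / 2) + T) with (T / 2) in H by field.
    rewrite Hodd in H. lra. }
  assert (Hn : forall n x, 0 <= x <= T / 2 + INR n * T -> d x = 0).
  { induction n as [|n IH]; intros x Hx.
    - simpl in Hx. destruct (Req_dec x 0) as [->|]; [exact H0|].
      destruct (Req_dec x (T / 2)) as [->|]; [exact H2|]. apply Hd; lra.
    - rewrite S_INR in Hx. pose proof (Rmult_le_pos (INR n) T (pos_INR n) ltac:(lra)).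
      destruct (Rle_lt_dec x (T / 2)); [apply IH; lra|].
      replace x with (x - T + T) by ring. rewrite Hper.
      destruct (Rle_lt_dec 0 (x - T)); [apply IH; lra|].
      rewrite <- (Ropp_involutive (x - T)), Hodd, IH; [ring|lra]. }
  assert (Hpos : forall x, 0 <= x -> d x = 0).
  { intros x Hx. destruct (INR_unbounded (x / T)) as [n Hnx]. apply (Hn n). split; [exact Hx|].
    assert (x < INR n * T); [|lra].
    replace x with (x / T * T) by (field; lra). now apply Rmult_lt_compat_r. }
  intros x. destruct (Rle_lt_dec 0 x); [now apply Hpos|].
  rewrite <- (Ropp_involutive x), Hodd, Hpos; lra.
Qed.

(** From [sinh x = 2 sinh (x / 2) cosh (x / 2)], both factors being at least [x / 4]. Quadratic
    growth suffices to compare with the inverse squares. *)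
Lemma sinh_ge_sqr (x : R) : 0 <= x -> x * x / 8 <= sinh x.
Proof.
  intros Hx. replace x with (2 * (x / 2)) at 3 by field. rewrite sinh_double.
  set (u := x / 2). assert (Hu : 0 <= u) by (unfold u; lra).
  assert (Hs : u / 2 <= sinh u).
  { unfold sinh. pose proof (exp_ineq1_le u). rewrite exp_Ropp.
    assert (/ exp u <= / (1 + u)) by (apply Rinv_le_contravar; lra).
    assert (/ (1 + u) <= / 1) by (apply Rinv_le_contravar; lra).
    lra. }
  assert (Hc : sinh u <= cosh u).
  { unfold sinh, cosh. pose proof (exp_pos (- u)). lra. }
  replace x with (2 * u) by (unfold u; field).
  assert (u / 2 * (u / 2) <= sinh u * cosh u) by (apply Rmult_le_compat; lra).
  nra.
Qed.

Definition csch_coeff (c : R) (n : nat) : R := / sinh (PI * c * INR (S n)).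

Definition csch_series (c t : R) : R := Series (fun n => csch_coeff c n * sin (INR (S n) * t)).

Lemma csch_coeff_pos (c : R) (n : nat) : 0 < c -> 0 < csch_coeff c n.
Proof.
  intros Hc. apply Rinv_0_lt_compat, sinh_pos. pose proof PI_RGT_0. pose proof (INR_S_ge1 n).
  apply Rmult_lt_0_compat; [apply Rmult_lt_0_compat|]; lra.
Qed.

Lemma ex_series_csch_coeff (c : R) : 0 < c -> ex_series (csch_coeff c).
Proof.
  intros Hc. apply (ex_series_dominated _ (fun n => 8 / ((PI * c) * (PI * c)) * / (INR (S n) * INR (S n)))).
  - intros n. rewrite Rabs_pos_eq by (left; now apply csch_coeff_pos).
    pose proof (INR_S_ge1 n). pose proof PI_RGT_0. pose proof (Rmult_lt_0_compat PI c H0 Hc).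
    unfold csch_coeff. set (k := INR (S n)) in *. set (p := PI * c) in *.
    pose proof (sinh_ge_sqr (p * k) ltac:(nra)).
    replace (8 / (p * p) * / (k * k)) with (/ (p * k * (p * k) / 8)) by (field; lra).
    apply Rinv_le_contravar; [|exact H2]. pose proof (Rmult_lt_0_compat p k). nra.
  - apply ex_series_Rscal, ex_series_inv_sqr.
Qed.

Lemma ex_series_abs_csch_coeff (c : R) : 0 < c -> ex_series (fun n => Rabs (csch_coeff c n)).
Proof.
  intros Hc. apply (ex_series_ext (csch_coeff c)); [|now apply ex_series_csch_coeff].
  intros n. symmetry. apply Rabs_pos_eq. left. now apply csch_coeff_pos.
Qed.

Lemma csch_series_opp (c t : R) : csch_series c (- t) = - csch_series c t.
Proof.
  unfold csch_series. rewrite <- Series_opp. apply Series_ext. intros n.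
  replace (INR (S n) * - t) with (- (INR (S n) * t)) by ring. rewrite sin_neg. ring.
Qed.

Lemma sin_INR_period (k : nat) (x : R) : sin (INR k * (x + 2 * PI)) = sin (INR k * x).
Proof.
  replace (INR k * (x + 2 * PI)) with (INR k * x + 2 * INR k * PI) by ring. apply sin_period.
Qed.

Lemma cos_INR_period (k : nat) (x : R) : cos (INR k * (x + 2 * PI)) = cos (INR k * x).
Proof.
  replace (INR k * (x + 2 * PI)) with (INR k * x + 2 * INR k * PI) by ring. apply cos_period.
Qed.

Lemma csch_series_period (c t : R) : csch_series c (t + 2 * PI) = csch_series c t.
Proof. unfold csch_series. apply Series_ext. intros n. now rewrite sin_INR_period. Qed.

Lemma is_RInt_cont (f : R -> R) (a b : R) :
  (forall x, continuous f x) -> is_RInt f a b (RInt f a b).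
Proof. intros Hf. now apply (@RInt_correct R_CompleteNormedModule), ex_RInt_cont. Qed.

(** This is [1 - tanh (PI x)]; it decays exponentially at plus infinity, which makes sums along
    arithmetic progressions absolutely convergent. *)
Local Notation kappa := (fermi (2 * PI)).

Lemma kappa_pos (x : R) : 0 < kappa x.
Proof.
  unfold fermi. pose proof (exp_pos (- (2 * PI * x))). apply Rdiv_lt_0_compat; lra.
Qed.

Lemma kappa_le (x : R) : kappa x <= 2 * exp (- (2 * PI * x)).
Proof.
  unfold fermi. pose proof (exp_pos (- (2 * PI * x))).
  rewrite <- (Rmult_1_r (2 * exp _)) at 2. unfold Rdiv. apply Rmult_le_compat_l; [lra|].
  assert (/ (1 + exp (- (2 * PI * x))) <= / 1) by (apply Rinv_le_contravar; lra). lra.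
Qed.

Lemma kappa_opp (x : R) : kappa (- x) = 2 - kappa x.
Proof.
  unfold fermi. replace (- (2 * PI * - x)) with (2 * PI * x) by ring. rewrite exp_Ropp.
  pose proof (exp_pos (2 * PI * x)). field. lra.
Qed.

Lemma kappa_arith_le (c z : R) (n : nat) :
  kappa (c * INR n + z) <= 2 * exp (- (2 * PI * z)) * exp (- (2 * PI * c)) ^ n.
Proof.
  eapply Rle_trans; [apply kappa_le|]. right.
  replace (exp (- (2 * PI * c)) ^ n) with (exp (INR n * - (2 * PI * c))).
  - rewrite (Rmult_assoc 2 (exp _)), <- exp_plus. do 2 f_equal. ring.
  - induction n as [|n IH]; [simpl; now rewrite Rmult_0_l, exp_0|].
    rewrite S_INR, Rmult_plus_distr_r, Rmult_1_l, exp_plus, IH. simpl. ring.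
Qed.

Lemma exp_neg_lt_1 (x : R) : 0 < x -> exp (- x) < 1.
Proof. intros Hx. rewrite <- exp_0. apply exp_increasing. lra. Qed.

Lemma ex_series_exp_geom (c : R) : 0 < c -> ex_series (fun n => exp (- (2 * PI * c)) ^ n).
Proof.
  intros Hc. apply ex_series_geom. rewrite Rabs_pos_eq by (left; apply exp_pos).
  apply exp_neg_lt_1. pose proof PI_RGT_0. nra.
Qed.

Lemma ex_series_kappa (c z : R) : 0 < c -> ex_series (fun n => kappa (c * INR n + z)).
Proof.
  intros Hc. eapply ex_series_dominated; [|apply ex_series_Rscal, (ex_series_exp_geom c Hc)].
  intros n. rewrite Rabs_pos_eq by (left; apply kappa_pos). apply kappa_arith_le.
Qed.

(** With [m = S n] this is [tanh (PI (y + m c)) + tanh (PI (y - m c))], written so that both parts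
    are small. *)
Definition kappa_term (c y : R) (n : nat) : R := kappa (c * INR (S n) - y) - kappa (c * INR (S n) + y).

Lemma kappa_term_abs_le (c A y : R) (n : nat) : 0 < c -> Rabs y < A ->
  Rabs (kappa_term c y n) <= 4 * exp (2 * PI * A) * exp (- (2 * PI * c)) ^ n.
Proof.
  intros Hc Hy. apply Rabs_def2 in Hy. pose proof PI_RGT_0.
  assert (Hz : forall z, - A <= z -> Rabs (kappa (c * INR (S n) + z))
            <= 2 * exp (2 * PI * A) * exp (- (2 * PI * c)) ^ n).
  { intros z Hz. rewrite Rabs_pos_eq by (left; apply kappa_pos).
    eapply Rle_trans; [apply kappa_arith_le|].
    pose proof (exp_pos (- (2 * PI * c))). pose proof (exp_neg_lt_1 (2 * PI * c) ltac:(nra)).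
    apply Rmult_le_compat.
    - pose proof (exp_pos (- (2 * PI * z))). lra.
    - left. now apply pow_lt.
    - apply Rmult_le_compat_l; [lra|].
      destruct (Rle_lt_or_eq_dec (- A) z Hz) as [Hlt| <-].
      + left. apply exp_increasing. nra.
      + right. f_equal. ring.
    - simpl. pose proof (pow_lt _ n H0). nra. }
  unfold kappa_term. eapply Rle_trans; [apply Rabs_triang|]. rewrite Rabs_Ropp.
  pose proof (Hz (- y) ltac:(lra)) as H1. pose proof (Hz y ltac:(lra)) as H2.
  unfold Rminus. lra.
Qed.

Lemma ex_series_kappa_bound (c A : R) : 0 < c ->
  ex_series (fun n => 4 * exp (2 * PI * A) * exp (- (2 * PI * c)) ^ n).
Proof. intros Hc. now apply ex_series_Rscal, ex_series_exp_geom. Qed.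

Lemma ex_series_kappa_term (c y : R) : 0 < c -> ex_series (kappa_term c y).
Proof.
  intros Hc. eapply ex_series_dominated; [|apply (ex_series_kappa_bound c (Rabs y + 1) Hc)].
  intros n. apply kappa_term_abs_le; [exact Hc|lra].
Qed.

Lemma continuous_kappa_term (c x : R) (n : nat) : continuous (fun y => kappa_term c y n) x.
Proof.
  apply (continuous_minus (fun y => kappa (c * INR (S n) - y)) (fun y => kappa (c * INR (S n) + y))).
  - apply (continuous_comp (fun y => c * INR (S n) - y) kappa); [|apply continuous_fermi].
    apply continuity_pt_filterlim. reg.
  - apply (continuous_comp (fun y => c * INR (S n) + y) kappa); [|apply continuous_fermi].
    apply continuity_pt_filterlim. reg.
Qed.

(* [c] times the symmetric sum of [tanh (PI * (y + n * c))] over all integers [n], made periodic by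
   subtracting its linear growth. *)
Definition tanh_comb (c y : R) : R := c * (1 - kappa y + Series (kappa_term c y)) - 2 * y.

Lemma tanh_comb_opp (c y : R) : tanh_comb c (- y) = - tanh_comb c y.
Proof.
  unfold tanh_comb. rewrite kappa_opp.
  rewrite (Series_ext (kappa_term c (- y)) (fun n => - kappa_term c y n)).
  - rewrite Series_opp. ring.
  - intros n. unfold kappa_term.
    replace (c * INR (S n) - - y) with (c * INR (S n) + y) by ring.
    replace (c * INR (S n) + - y) with (c * INR (S n) - y) by ring. ring.
Qed.

Lemma is_series_telescope (a : nat -> R) (l : R) :
  is_lim_seq a l -> is_series (fun n => a n - a (S n)) (a 0%nat - l).
Proof.
  intros Ha.
  change (is_lim_seq (sum_n (fun n => a n - a (S n))) (a 0%nat - l)).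
  apply (is_lim_seq_ext (fun n => a 0%nat - a (S n))).
  - intros n. induction n as [|n IH]; [now rewrite sum_O|].
    rewrite sum_Sn, <- IH. to_R. ring.
  - apply is_lim_seq_minus'; [apply is_lim_seq_const|]. now apply is_lim_seq_incr_1 in Ha.
Qed.

Lemma is_lim_seq_kappa (c z : R) : 0 < c -> is_lim_seq (fun n => kappa (c * INR n + z)) 0.
Proof. intros Hc. apply ex_series_lim_0. now apply ex_series_kappa. Qed.

(** Shifting by [c] moves each family of terms by one index, so the series gains the boundary terms
    [kappa (- y) + kappa (c + y)]. As [kappa (- y) = 2 - kappa y], the surplus [2 c] is what the
    subtracted line [2 y] absorbs. *)
Lemma tanh_comb_period (c y : R) : 0 < c -> tanh_comb c (y + c) = tanh_comb c y.
Proof.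
  intros Hc. unfold tanh_comb.
  pose proof (is_series_telescope _ _ (is_lim_seq_kappa c (- y) Hc)) as H1.
  pose proof (is_series_telescope _ _ (is_lim_seq_kappa c (c + y) Hc)) as H2.
  assert (H3 : is_series (fun n => (kappa (c * INR n + - y) - kappa (c * INR (S n) + - y)) +
      (kappa (c * INR n + (c + y)) - kappa (c * INR (S n) + (c + y))))
      ((kappa (c * INR 0 + - y) - 0) + (kappa (c * INR 0 + (c + y)) - 0)))
    by exact (is_series_plus _ _ _ _ H1 H2).
  assert (E : Series (kappa_term c (y + c)) = Series (kappa_term c y) +
     (kappa (- y) + kappa (c + y))).
  { rewrite (Series_ext (kappa_term c (y + c)) (fun n => kappa_term c y n +
       ((kappa (c * INR n + - y) - kappa (c * INR (S n) + - y)) +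
         (kappa (c * INR n + (c + y)) - kappa (c * INR (S n) + (c + y)))))).
    - rewrite Series_plus.
      + rewrite (is_series_unique _ _ H3). simpl INR. rewrite !Rmult_0_r, !Rplus_0_l. ring.
      + now apply ex_series_kappa_term.
      + eexists. exact H3.
    - intros n. unfold kappa_term. rewrite S_INR.
      replace (c * (INR n + 1) - (y + c)) with (c * INR n + - y) by ring.
      replace (c * INR n + (c + y)) with (c * (INR n + 1) + y) by ring.
      replace (c * (INR n + 1) + (c + y)) with (c * (INR n + 1) + (y + c)) by ring.
      replace (c * (INR n + 1) + - y) with (c * (INR n + 1) - y) by ring.
      ring. }
  rewrite E, kappa_opp, (Rplus_comm c y). ring.
Qed.

Lemma continuous_tanh_comb (c x : R) : 0 < c -> continuous (tanh_comb c) x.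
Proof.
  intros Hc.
  apply (continuous_minus (fun y => c * (1 - kappa y + Series (kappa_term c y))) (fun y => 2 * y)).
  - apply (continuous_mult (fun _ => c)); [apply continuous_const|].
    apply (continuous_plus (fun y => 1 - kappa y)).
    + apply (continuous_minus (fun _ => 1)); [apply continuous_const | apply continuous_fermi].
    + apply (continuous_Series (fun n y => kappa_term c y n) _ (Rabs x + 1) x
        (ex_series_kappa_bound c (Rabs x + 1) Hc)).
      * lra.
      * intros n t Ht. now apply kappa_term_abs_le.
      * intros n. apply continuous_kappa_term.
  - apply continuity_pt_filterlim. reg.
Qed.

Lemma kappa_sin_cont (w x : R) : continuous (fun x => kappa x * sin (w * x)) x.
Proof. apply (continuous_mult kappa); [apply continuous_fermi | apply continuous_sin_lin]. Qed.

(** Unfolding: [sin (w y)] has period dividing [c], so the [n]-th term integrates to minus an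
    integral of [kappa x * sin (w x)] over one period centred at [(n + 1) c]. These windows tile the
    half line from [c / 2], the isolated [- kappa y] fills [[0, c / 2]], and together they give
    [- l], the full transform at [xi = k / c] (with [k] counted from 1). *)
Lemma tanh_comb_sine_coeff_unscaled (c : R) (k : nat) : 0 < c ->
  is_RInt (fun y => tanh_comb c y * sin (2 * PI * (INR (S k) / c) * y)) 0 (c / 2)
    (c / 2 * csch_coeff (/ c) k).
Proof.
  intros Hc. pose proof PI_RGT_0 as HPI. pose proof (INR_S_ge1 k) as Hk.
  set (xi := INR (S k) / c). set (w := 2 * PI * xi).
  assert (Hxi : 0 < xi) by (apply Rdiv_lt_0_compat; lra).
  assert (Hw : 0 < w) by (unfold w; nra).
  set (Phi := (fun B => RInt (fun x => kappa x * sin (w * x)) 0 B) : R -> R).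
  set (l := (/ xi - PI / sinh (PI * xi)) / (2 * PI)).
  assert (HPhi : forall a b, is_RInt (fun x => kappa x * sin (w * x)) a b (Phi b - Phi a)).
  { intros a b. replace (Phi b - Phi a) with (- Phi a + Phi b) by ring.
    refine (is_RInt_Chasles (V := R_NormedModule) _ a 0 b (- Phi a) (Phi b) _ _).
    - apply (is_RInt_swap (V := R_NormedModule)), is_RInt_cont, kappa_sin_cont.
    - apply is_RInt_cont, kappa_sin_cont. }
  assert (Hlim : is_lim_seq (fun n => Phi (c * INR n + c / 2)) l).
  { apply is_lim_seq_spec. intros eps. pose proof (cond_pos eps) as Heps.
    destruct (INR_unbounded ((1 + 8 / eps) / c)) as [N HN]. exists N. intros n Hn.
    assert (HB : 1 + 8 / eps < c * INR n + c / 2).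
    { assert (INR N <= INR n) by now apply le_INR.
      assert (1 + 8 / eps < c * INR N).
      { replace (1 + 8 / eps) with (c * ((1 + 8 / eps) / c)) by (field; split; lra).
        apply Rmult_lt_compat_l; lra. }
      nra. }
    set (B := c * INR n + c / 2) in *.
    assert (0 < 8 / eps) by (apply Rdiv_lt_0_compat; [lra|apply cond_pos]).
    eapply Rle_lt_trans.
    - unfold Phi, l. rewrite (RInt_ext _ (fun x => (1 - tanh (PI * x)) * sin (2 * PI * xi * x))).
      + apply one_minus_tanh_sin_integral_close; lra.
      + intros x _. now rewrite fermi_2PI.
    - rewrite exp_Ropp. pose proof (exp_ineq1_le (2 * PI * B)).
      assert (8 / eps < exp (2 * PI * B)).
      { pose proof PI2_1. nra. }
      replace (pos eps) with (8 * / (8 / eps)) by (field; lra).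
      apply Rmult_lt_compat_l; [lra|]. apply Rinv_lt_contravar; [|lra].
      apply Rmult_lt_0_compat; lra. }
  assert (Hterm : forall n, is_RInt (fun y => kappa_term c y n * sin (w * y)) 0 (c / 2)
            (Phi (c * INR n + c / 2) - Phi (c * INR (S n) + c / 2))).
  (* The window is [[m - c / 2, m + c / 2]] with [m = c * INR (S n)], so its left end is
     [c * INR n + c / 2] and consecutive terms telescope. *)
  { intros n.
    assert (Hsin : forall y, sin (w * (c * INR (S n) + y)) = sin (w * y)).
    { intros y. replace (w * (c * INR (S n) + y)) with (w * y + 2 * INR (S n * S k) * PI).
      - apply sin_period.
      - rewrite mult_INR. unfold w, xi. field. lra. }
    set (m := c * INR (S n)) in *.
    pose proof (is_RInt_comp_lin _ (-1) m 0 (c / 2) _ (HPhi (-1 * 0 + m) (-1 * (c / 2) + m))) as H1.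
    pose proof (is_RInt_comp_lin _ 1 m 0 (c / 2) _ (HPhi (1 * 0 + m) (1 * (c / 2) + m))) as H2.
    pose proof (is_RInt_minus _ _ _ _ _ _ H1 H2) as H3.
    replace (Phi (c * INR n + c / 2) - Phi (m + c / 2)) with
      (minus (Phi (-1 * (c / 2) + m) - Phi (-1 * 0 + m)) (Phi (1 * (c / 2) + m) - Phi (1 * 0 + m))).
    2:{ to_R. replace (-1 * 0 + m) with m by ring. replace (1 * 0 + m) with m by ring.
        replace (1 * (c / 2) + m) with (m + c / 2) by ring.
        replace (-1 * (c / 2) + m) with (c * INR n + c / 2) by (unfold m; rewrite S_INR; field).
        ring. }
    eapply is_RInt_ext; [|exact H3]. intros y _. to_R. unfold kappa_term. fold m.
    replace (-1 * y + m) with (m + - y) by ring. replace (1 * y + m) with (m + y) by ring.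
    rewrite !Hsin. replace (w * - y) with (- (w * y)) by ring. rewrite sin_neg.
    unfold Rminus. to_R. ring. }
  assert (Hsum : is_RInt (fun y => Series (kappa_term c y) * sin (w * y)) 0 (c / 2)
            (Phi (c / 2) - l)).
  { assert (HI : is_RInt (fun y => Series (kappa_term c y) * sin (w * y)) 0 (c / 2)
       (RInt (fun y => Series (kappa_term c y) * sin (w * y)) 0 (c / 2))).
    { apply is_RInt_cont. intros x.
      apply (continuous_mult (fun y => Series (kappa_term c y))); [|apply continuous_sin_lin].
      apply (continuous_Series (fun n y => kappa_term c y n) _ (Rabs x + 1) x
        (ex_series_kappa_bound c (Rabs x + 1) Hc)).
      - lra.
      - intros n t Ht. now apply kappa_term_abs_le.
      - intros n. apply continuous_kappa_term. }
    assert (HS : is_series (fun n => Phi (c * INR n + c / 2) - Phi (c * INR (S n) + c / 2))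
       (RInt (fun y => Series (kappa_term c y) * sin (w * y)) 0 (c / 2))).
    { apply (is_series_RInt (fun n y => kappa_term c y n * sin (w * y)) _ _ 0 (c / 2) _
        ltac:(lra) (ex_series_kappa_bound c c Hc)).
      - intros n t Ht.
        assert (Rabs (sin (w * t)) <= 1) by apply Rabs_le, SIN_bound.
        pose proof (kappa_term_abs_le c c t n Hc ltac:(rewrite Rabs_pos_eq; lra)).
        rewrite Rabs_mult. pose proof (Rabs_pos (kappa_term c t n)). nra.
      - exact Hterm.
      - eapply is_RInt_ext; [|exact HI]. intros y _. simpl. now rewrite <- Series_scal_r. }
    pose proof (is_series_telescope _ _ Hlim) as HT.
    apply is_series_unique in HS. apply is_series_unique in HT. rewrite HS in HT.
    simpl (INR 0) in HT. rewrite Rmult_0_r, Rplus_0_l in HT. rewrite <- HT. exact HI. }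
  (* The remaining part of [tanh_comb]; its coefficient [c / w] cancels the [/ xi] in [c * l],
     leaving only the [1 / sinh] term. *)
  assert (Hlin : is_RInt (fun y => (c - 2 * y) * sin (w * y)) 0 (c / 2) (c / w)).
  { set (F := fun y => - (c - 2 * y) * cos (w * y) / w - 2 * sin (w * y) / (w * w)).
    assert (HF : c / w = F (c / 2) - F 0).
    { unfold F. rewrite !Rmult_0_r, sin_0, cos_0.
      replace (w * (c / 2)) with (INR (S k) * PI) by (unfold w, xi; field; lra).
      rewrite sin_INR_PI. field. lra. }
    rewrite HF. apply (is_RInt_derive F).
    - intros y _. unfold F. auto_derive; [exact I|]. field. lra.
    - intros y _. apply continuity_pt_filterlim. reg. }
  pose proof (is_RInt_scal _ _ _ c _ (is_RInt_minus _ _ _ _ _ _ Hsum (HPhi 0 (c / 2)))) as H5.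
  pose proof (is_RInt_plus _ _ _ _ _ _ Hlin H5) as H6.
  assert (HPhi0 : Phi 0 = 0) by exact (RInt_point (V := R_CompleteNormedModule) 0 _).
  replace (c / 2 * csch_coeff (/ c) k) with
     (plus (c / w) (scal c (minus (Phi (c / 2) - l) (Phi (c / 2) - Phi 0)))).
  2:{ to_R. rewrite HPhi0. unfold csch_coeff.
      replace (PI * / c * INR (S k)) with (PI * xi) by (unfold xi; field; lra).
      assert (0 < sinh (PI * xi)) by (apply sinh_pos; nra).
      unfold l, w. field. lra. }
  eapply is_RInt_ext; [|exact H6]. intros y _. to_R. unfold tanh_comb. ring.
Qed.

(** The modular step: [c] on the left, [/ c] on the right. For [c = K'/K] the right side is [frakf]
    at the complementary modulus. *)
Lemma tanh_comb_fourier (c y : R) : 0 < c ->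
  tanh_comb c y = 2 * csch_series (/ c) (2 * PI / c * y).
Proof.
  intros Hc. pose proof PI_RGT_0 as HPI.
  assert (Hc' : 0 < / c) by now apply Rinv_0_lt_compat.
  apply Rminus_diag_uniq.
  apply (odd_periodic_zero (fun y => tanh_comb c y - 2 * csch_series (/ c) (2 * PI / c * y)) c Hc).
  - intros x. rewrite tanh_comb_opp.
    replace (2 * PI / c * - x) with (- (2 * PI / c * x)) by ring. rewrite csch_series_opp. ring.
  - intros x. rewrite tanh_comb_period by exact Hc.
    replace (2 * PI / c * (x + c)) with (2 * PI / c * x + 2 * PI) by (field; lra).
    now rewrite csch_series_period.
  - clear y. intros y Hy.
    set (u := c / (2 * PI)).
    assert (Hu : 0 < u) by (apply Rdiv_lt_0_compat; lra).
    assert (Hrep : tanh_comb c (u * (2 * PI / c * y))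
       = Series (fun n => 2 * csch_coeff (/ c) n * sin (INR (S n) * (2 * PI / c * y)))).
    { apply (sine_series_representation (fun t => tanh_comb c (u * t)) (fun n => 2 * csch_coeff (/ c) n)).
      - intros t. apply (continuous_comp (fun t => u * t) (tanh_comb c)).
        + apply continuity_pt_filterlim. reg.
        + now apply continuous_tanh_comb.
      - eapply ex_series_ext; [|apply (ex_series_Rscal 2), (ex_series_abs_csch_coeff (/ c) Hc')].
        intros n. rewrite Rabs_mult, (Rabs_pos_eq 2) by lra. reflexivity.
      - intros k.
        pose proof (tanh_comb_sine_coeff_unscaled c k Hc) as H.
        replace 0 with (u * 0 + 0) in H by ring.
        replace (c / 2) with (u * PI + 0) in H at 1 by (unfold u; field; lra).
        apply is_RInt_comp_lin in H.
        apply (is_RInt_scal _ _ _ (/ u)) in H.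
        replace (PI / 2 * (2 * csch_coeff (/ c) k)) with (scal (/ u) (c / 2 * csch_coeff (/ c) k)).
        2:{ to_R. unfold u. field. lra. }
        eapply is_RInt_ext; [|exact H]. intros t _. to_R.
        replace (2 * PI * (INR (S k) / c) * (u * t + 0)) with (INR (S k) * t) by (unfold u; field; lra).
        rewrite Rplus_0_r. field. lra.
      - split.
        + apply Rmult_lt_0_compat; [apply Rdiv_lt_0_compat; lra | lra].
        + apply Rmult_lt_reg_r with u; [exact Hu|].
          replace (2 * PI / c * y * u) with y by (unfold u; field; lra).
          replace (PI * u) with (c / 2) by (unfold u; field; lra). lra. }
    replace (u * (2 * PI / c * y)) with y in Hrep by (unfold u; field; lra).
    rewrite Hrep. unfold csch_series. rewrite <- Series_scal_l.
    apply Rminus_diag_eq, Series_ext. intros n. ring.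
Qed.

(** * The logarithmic derivative of theta4 on the real line *)

Definition theta_coeff (c : R) (n : nat) : R := (-1) ^ n * exp (- (PI * c * (INR n * INR n))).

Lemma theta_coeff_0 (c : R) : theta_coeff c 0 = 1.
Proof. unfold theta_coeff. simpl. rewrite !Rmult_0_r, Ropp_0, exp_0. ring. Qed.

(** From [exp x >= sinh x >= x^2 / 8] at [x = PI c k^2], [k] being the index. The extra factor [k]
    lets one majorant serve both the theta series and its derivative. *)
Lemma theta_coeff_abs_le (c : R) (n : nat) : 0 < c ->
  Rabs (INR (S n) * theta_coeff c (S n))
  <= 8 / ((PI * c) * (PI * c)) * / (INR (S n) * INR (S n)).
Proof.
  intros Hc. unfold theta_coeff. pose proof (INR_S_ge1 n). pose proof PI_RGT_0.
  pose proof (Rmult_lt_0_compat PI c H0 Hc). set (p := PI * c) in *. set (k := INR (S n)) in *.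
  rewrite !Rabs_mult, pow_1_abs, Rmult_1_l, Rabs_pos_eq, Rabs_pos_eq by (try (left; apply exp_pos); lra).
  rewrite exp_Ropp.
  assert (Hk : 1 <= k * k) by nra. assert (Hx : 0 < p * (k * k)) by (apply Rmult_lt_0_compat; lra).
  pose proof (sinh_ge_sqr (p * (k * k)) ltac:(lra)) as Hs.
  assert (He : sinh (p * (k * k)) <= exp (p * (k * k))).
  { unfold sinh. pose proof (exp_pos (p * (k * k))). pose proof (exp_pos (- (p * (k * k)))). lra. }
  assert (Hi : / exp (p * (k * k)) <= / (p * (k * k) * (p * (k * k)) / 8)).
  { apply Rinv_le_contravar; [|lra]. pose proof (Rmult_lt_0_compat _ _ Hx Hx). lra. }
  replace (8 / (p * p) * / (k * k)) with (k * k * / (p * (k * k) * (p * (k * k)) / 8)) by (field; lra).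
  assert (0 < / (p * (k * k) * (p * (k * k)) / 8)).
  { apply Rinv_0_lt_compat. pose proof (Rmult_lt_0_compat _ _ Hx Hx). lra. }
  eapply Rle_trans; [apply Rmult_le_compat_l; [lra|exact Hi]|].
  apply Rmult_le_compat_r; nra.
Qed.

Lemma ex_series_theta_bound (c : R) :
  ex_series (fun n => 8 / ((PI * c) * (PI * c)) * / (INR (S n) * INR (S n))).
Proof. apply ex_series_Rscal, ex_series_inv_sqr. Qed.

Lemma theta_coeff_abs_le' (c : R) (n : nat) : 0 < c ->
  Rabs (theta_coeff c (S n)) <= 8 / ((PI * c) * (PI * c)) * / (INR (S n) * INR (S n)).
Proof.
  intros Hc. eapply Rle_trans; [|now apply theta_coeff_abs_le].
  rewrite Rabs_mult. pose proof (INR_S_ge1 n).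
  rewrite (Rabs_pos_eq (INR (S n))) by lra. pose proof (Rabs_pos (theta_coeff c (S n))). nra.
Qed.

Lemma ex_series_abs_theta_coeff (c : R) : 0 < c ->
  ex_series (fun n => Rabs (2 * theta_coeff c (S n))).
Proof.
  intros Hc. eapply ex_series_dominated; [|apply (ex_series_Rscal 2), (ex_series_theta_bound c)].
  intros n. cbv beta. rewrite Rabs_Rabsolu, Rabs_mult, (Rabs_pos_eq 2) by lra.
  apply Rmult_le_compat_l; [lra|]. now apply theta_coeff_abs_le'.
Qed.

(** This is [theta4] at the real point [t / 2] for [tau = i c]. Doubling the variable gives integer
    frequencies and period [2 PI]. *)
Definition theta_cos (c t : R) : R :=
  1 + Series (fun n => 2 * theta_coeff c (S n) * cos (INR (S n) * t)).

Definition theta_cos' (c t : R) : R :=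
  Series (fun n => -2 * (INR (S n) * theta_coeff c (S n)) * sin (INR (S n) * t)).

Lemma cosine_series_abs_le (b : R) (n : nat) (t : R) : Rabs (b * cos (INR n * t)) <= Rabs b.
Proof.
  rewrite Rabs_mult. rewrite <- (Rmult_1_r (Rabs b)) at 2.
  apply Rmult_le_compat_l; [apply Rabs_pos|].
  apply Rabs_le, COS_bound.
Qed.

Lemma ex_series_theta_cos (c t : R) : 0 < c ->
  ex_series (fun n => 2 * theta_coeff c (S n) * cos (INR (S n) * t)).
Proof.
  intros Hc. eapply ex_series_dominated; [|now apply (ex_series_abs_theta_coeff c)].
  intros n. apply cosine_series_abs_le.
Qed.

Lemma is_derive_theta_cos (c t : R) : 0 < c -> is_derive (theta_cos c) t (theta_cos' c t).
Proof.
  intros Hc. unfold theta_cos, theta_cos'.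
  rewrite <- (Rplus_0_l (Series _)).
  apply (is_derive_plus (fun _ => 1)
    (fun t => Series (fun n => 2 * theta_coeff c (S n) * cos (INR (S n) * t))) t 0).
  { apply (is_derive_const (V := R_NormedModule)). }
  apply (is_derive_Series (fun n t => 2 * theta_coeff c (S n) * cos (INR (S n) * t))
     (fun n t => -2 * (INR (S n) * theta_coeff c (S n)) * sin (INR (S n) * t))
     (fun n => 2 * (8 / ((PI * c) * (PI * c)) * / (INR (S n) * INR (S n))))).
  - apply ex_series_Rscal, ex_series_theta_bound.
  - intros n x. eapply Rle_trans; [apply sine_series_abs_le|].
    rewrite Rabs_mult. replace (Rabs (-2)) with 2 by (rewrite Rabs_left; lra).
    apply Rmult_le_compat_l; [lra|]. now apply theta_coeff_abs_le.
  - intros x. now apply ex_series_theta_cos.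
  - intros n x. set (k := INR (S n)). auto_derive; [exact I|ring].
  - intros n x. set (k := INR (S n)). apply continuity_pt_filterlim. reg.
Qed.

Lemma continuous_theta_cos (c t : R) : 0 < c -> continuous (theta_cos c) t.
Proof.
  intros Hc. apply (ex_derive_continuous (V := R_NormedModule)). eexists. now apply is_derive_theta_cos.
Qed.

Lemma cosine_orthogonality (m n : nat) :
  is_RInt (fun t => cos (INR (S m) * t) * cos (INR n * t)) 0 PI
    (if Nat.eq_dec (S m) n then PI / 2 else 0).
Proof.
  destruct (Nat.eq_dec (S m) n) as [<-|Hne].
  - assert (Hk : INR (S m) <> 0) by (apply not_0_INR; lia).
    set (k := INR (S m)) in *.
    replace (PI / 2) with ((PI / 2 + sin (2 * k * PI) / (4 * k)) - (0 / 2 + sin (2 * k * 0) / (4 * k))).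
    2:{ replace (2 * k * PI) with (0 + 2 * k * PI) by ring. unfold k at 1.
        rewrite sin_period, Rmult_0_r, sin_0. field. exact Hk. }
    apply (is_RInt_derive (fun t => t / 2 + sin (2 * k * t) / (4 * k))).
    + intros t _. auto_derive; [exact I|].
      replace (2 * k * t) with (2 * (k * t)) by ring. rewrite cos_2a_cos. field. exact Hk.
    + intros t _. apply continuity_pt_filterlim. reg.
  - set (k := INR (S m)). set (l := INR n).
    assert (H1 : k - l <> 0).
    { unfold k, l. intros H. apply Hne, INR_eq. lra. }
    assert (H2 : k + l <> 0).
    { unfold k, l. pose proof (pos_INR n). rewrite S_INR. pose proof (pos_INR m). lra. }
    assert (Hm : sin ((k - l) * PI) = 0).
    { replace ((k - l) * PI) with (k * PI - l * PI) by ring.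
      rewrite sin_minus. unfold k, l. rewrite !sin_INR_PI. ring. }
    assert (Hp : sin ((k + l) * PI) = 0).
    { replace ((k + l) * PI) with (k * PI + l * PI) by ring.
      rewrite sin_plus. unfold k, l. rewrite !sin_INR_PI. ring. }
    replace 0 with ((sin ((k - l) * PI) / (2 * (k - l)) + sin ((k + l) * PI) / (2 * (k + l)))
       - (sin ((k - l) * 0) / (2 * (k - l)) + sin ((k + l) * 0) / (2 * (k + l)))) at 2.
    2:{ rewrite Hm, Hp, !Rmult_0_r, sin_0. field. auto. }
    apply (is_RInt_derive (fun t => sin ((k - l) * t) / (2 * (k - l)) + sin ((k + l) * t) / (2 * (k + l)))).
    + intros t _. auto_derive; [exact I|].
      replace ((k - l) * t) with (k * t - l * t) by ring.
      replace ((k + l) * t) with (k * t + l * t) by ring.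
      rewrite cos_minus, cos_plus. field. auto.
    + intros t _. apply continuity_pt_filterlim. reg.
Qed.

Lemma theta_cos_coeff (c : R) (j : nat) : 0 < c ->
  is_RInt (fun t => theta_cos c t * cos (INR j * t)) 0 PI (PI * theta_coeff c j).
Proof.
  intros Hc. pose proof PI_RGT_0.
  set (g := fun t => Series (fun n => 2 * theta_coeff c (S n) * cos (INR (S n) * t)) * cos (INR j * t)).
  assert (Hgc : forall x, continuous g x).
  { intros x. apply (continuous_mult (fun t => Series (fun n => 2 * theta_coeff c (S n) * cos (INR (S n) * t)))).
    - apply (continuous_ext (fun t => theta_cos c t - 1)); [intros t; unfold theta_cos; simpl; ring|].
      apply (continuous_minus (theta_cos c) (fun _ => 1)); [now apply continuous_theta_cos|apply continuous_const].
    - apply continuous_cos_lin. }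
  assert (Hs : is_series (fun n => 2 * theta_coeff c (S n) * (if Nat.eq_dec (S n) j then PI / 2 else 0))
                 (RInt g 0 PI)).
  { apply (is_series_RInt
      (fun n t => 2 * theta_coeff c (S n) * cos (INR (S n) * t) * cos (INR j * t))
      (fun n => Rabs (2 * theta_coeff c (S n))) _ 0 PI).
    - lra.
    - now apply ex_series_abs_theta_coeff.
    - intros n t _. eapply Rle_trans; [apply cosine_series_abs_le|apply cosine_series_abs_le].
    - intros n. eapply is_RInt_ext;
        [|apply (is_RInt_scal _ _ _ (2 * theta_coeff c (S n)) _ (cosine_orthogonality n j))].
      intros t _. to_R. ring.
    - eapply is_RInt_ext; [|apply is_RInt_cont, Hgc]. intros t _. unfold g. now rewrite <- Series_scal_r. }
  apply is_series_unique in Hs.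
  assert (H1 : is_RInt (fun t => cos (INR j * t)) 0 PI (if Nat.eq_dec j 0 then PI else 0)).
  { destruct (Nat.eq_dec j 0) as [->|Hj].
    - apply (is_RInt_ext (fun _ => 1)); [intros t _; simpl; now rewrite Rmult_0_l, cos_0|].
      replace PI with (scal (PI - 0) 1) at 2 by (to_R; ring). apply @is_RInt_const.
    - assert (INR j <> 0) by (apply not_0_INR; lia).
      replace 0 with (sin (INR j * PI) / INR j - sin (INR j * 0) / INR j) at 2.
      2:{ rewrite sin_INR_PI, Rmult_0_r, sin_0. field. assumption. }
      apply (is_RInt_derive (fun t => sin (INR j * t) / INR j)).
      + intros t _. auto_derive; [exact I|]. field. assumption.
      + intros t _. apply continuous_cos_lin. }
  replace (PI * theta_coeff c j) with ((if Nat.eq_dec j 0 then PI else 0) + RInt g 0 PI).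
  - eapply is_RInt_ext; [|exact (is_RInt_plus _ _ _ _ _ _ H1 (is_RInt_cont g 0 PI Hgc))].
    intros t _. to_R. unfold g, theta_cos. ring.
  - rewrite <- Hs. destruct j as [|j].
    + destruct (Nat.eq_dec 0 0) as [_|]; [|lia]. rewrite theta_coeff_0.
      rewrite (Series_ext _ (fun n => 0 * 0)).
      * rewrite Series_scal_l. ring.
      * intros n. destruct Nat.eq_dec; [lia|ring].
    + destruct (Nat.eq_dec (S j) 0) as [|_]; [lia|].
      pose proof (is_series_single (fun n => 2 * theta_coeff c (S n) * (if Nat.eq_dec (S n) (S j) then PI / 2 else 0)) j) as H2.
      rewrite (is_series_unique _ _ (H2 ltac:(intros n Hn; cbv beta;
        destruct (Nat.eq_dec (S n) (S j)); [lia|ring]))).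
      destruct (Nat.eq_dec (S j) (S j)); [field|lia].
Qed.

(** With [q = exp (- PI c)]: [q^((m - n)^2) - q^((m + n)^2) = q^(m^2 + n^2) (q^(-2 m n) - q^(2 m
    n))], and [m - n], [m + n] have the same parity. The disjunction encodes [d = |m - n|] without
    truncated subtraction. *)
Lemma theta_coeff_diff_sum (c : R) (m n d : nat) : (m = n + d \/ n = m + d)%nat ->
  theta_coeff c d - theta_coeff c (m + n)
  = theta_coeff c n * theta_coeff c m * (2 * sinh (2 * (PI * c) * INR n * INR m)).
Proof.
  intros Hd. unfold theta_coeff.
  assert (Hsg : (-1) ^ d = (-1) ^ n * (-1) ^ m).
  { rewrite <- pow_add. destruct Hd as [-> | ->].
    - replace (n + (n + d))%nat with (2 * n + d)%nat by lia.
      rewrite pow_add, pow_mult. replace ((-1) ^ 2) with 1 by ring. rewrite pow1. ring.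
    - replace (m + d + m)%nat with (2 * m + d)%nat by lia.
      rewrite pow_add, pow_mult. replace ((-1) ^ 2) with 1 by ring. rewrite pow1. ring. }
  assert (Hsq : INR d * INR d = (INR m - INR n) * (INR m - INR n)).
  { destruct Hd as [-> | ->]; rewrite plus_INR; ring. }
  rewrite Hsg, Hsq, pow_add, plus_INR. unfold sinh.
  set (p := PI * c). set (x := INR m). set (y := INR n).
  replace (- (p * ((x - y) * (x - y)))) with (- (p * (y * y)) + (- (p * (x * x)) + 2 * p * y * x)) by ring.
  replace (- (p * ((x + y) * (x + y)))) with (- (p * (y * y)) + (- (p * (x * x)) + - (2 * p * y * x))) by ring.
  rewrite !exp_plus. field.
Qed.

Lemma theta_cos_sin_sin (c : R) (m n : nat) : 0 < c ->
  is_RInt (fun t => theta_cos c t * (sin (INR m * t) * sin (INR n * t))) 0 PI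
    (PI * (theta_coeff c n * theta_coeff c m * sinh (2 * (PI * c) * INR n * INR m))).
Proof.
  intros Hc.
  assert (H : forall d, (m = n + d \/ n = m + d)%nat ->
     is_RInt (fun t => theta_cos c t * (sin (INR m * t) * sin (INR n * t))) 0 PI
       (/ 2 * (PI * theta_coeff c d - PI * theta_coeff c (m + n)))).
  { intros d Hd.
    pose proof (is_RInt_scal _ _ _ (/ 2) _ (is_RInt_minus _ _ _ _ _ _
      (theta_cos_coeff c d Hc) (theta_cos_coeff c (m + n) Hc))) as HI.
    eapply is_RInt_ext; [|exact HI]. intros t _. to_R.
    rewrite plus_INR, Rmult_plus_distr_r, cos_plus.
    replace (cos (INR d * t)) with (cos (INR m * t - INR n * t)).
    - rewrite cos_minus. field.
    - destruct Hd as [-> | ->]; rewrite plus_INR.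
      + f_equal. ring.
      + rewrite <- cos_neg. f_equal. ring. }
  assert (Hd : exists d, (m = n + d \/ n = m + d)%nat).
  { destruct (Nat.le_ge_cases n m) as [Hle|Hle];
      [exists (m - n)%nat; left; lia | exists (n - m)%nat; right; lia]. }
  destruct Hd as [d Hd]. specialize (H d Hd).
  replace (PI * (theta_coeff c n * theta_coeff c m * sinh (2 * (PI * c) * INR n * INR m)))
    with (/ 2 * (PI * theta_coeff c d - PI * theta_coeff c (m + n))); [exact H|].
  rewrite <- Rmult_minus_distr_l, (theta_coeff_diff_sum c m n d Hd). field.
Qed.

(** Telescoping with stride [M + 1]: only the first [M + 1] values are left uncancelled. *)
Lemma is_series_window (b : nat -> R) (M : nat) : is_lim_seq b 0 ->
  is_series (fun m => b m - b (m + S M)%nat) (sum_n b M).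
Proof.
  intros Hb. induction M as [|M IH].
  - rewrite sum_O. replace (b 0%nat) with (b 0%nat - 0) by ring.
    eapply is_series_ext; [|apply (is_series_telescope b 0 Hb)].
    intros n. simpl. now rewrite Nat.add_1_r.
  - rewrite sum_Sn.
    assert (H : is_series (fun m => b (m + S M)%nat - b (S m + S M)%nat) (b (S M))).
    { replace (b (S M)) with (b (0 + S M)%nat - 0) by (simpl; ring).
      apply (is_series_telescope (fun m => b (m + S M)%nat)).
      now apply (is_lim_seq_incr_n b (S M)) in Hb. }
    eapply is_series_ext; [|exact (is_series_plus _ _ _ _ IH H)].
    intros n. to_R. replace (n + S (S M))%nat with (S n + S M)%nat by lia. ring.
Qed.

Lemma antisymmetric_sum (f : nat -> R) (M : nat) :
  (forall m, (m <= M)%nat -> f (M - m)%nat = - f m) -> sum_f_R0 f M = 0.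
Proof.
  intros H. pose proof (sum_f_R0_skip f M) as Hs.
  rewrite (sum_eq _ (fun m => f m * -1)) in Hs.
  - rewrite <- scal_sum in Hs. change (-1 * sum_f_R0 f M = sum_f_R0 f M) in Hs. lra.
  - intros m Hm. rewrite H by exact Hm. ring.
Qed.

(* The bilateral theta series with terms [b m] vanishes because [b (L - m) = - b m] for odd [L]. *)
Lemma theta_cosh_series (c : R) (N : nat) : 0 < c ->
  is_series (fun n => theta_coeff c (S n) * (2 * cosh (PI * c * INR (2 * N + 1) * INR (S n)))) (-1).
Proof.
  intros Hc. pose proof PI_RGT_0. set (p := PI * c).
  assert (Hp : 0 < p) by (apply Rmult_lt_0_compat; lra).
  set (L := INR (2 * N + 1)).
  set (b := fun m => (-1) ^ m * exp (- (p * (INR m * INR m - L * INR m)))).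
  assert (Hodd : (-1) ^ (2 * N + 1) = -1).
  { rewrite pow_add, pow_mult. replace ((-1) ^ 2) with 1 by ring. rewrite pow1. ring. }
  assert (Hlim : is_lim_seq b 0).
  { apply is_lim_seq_spec. intros eps. pose proof (cond_pos eps) as He.
    destruct (INR_unbounded (/ (p * eps))) as [N1 HN1].
    exists (2 * N + 2 + N1)%nat. intros n Hn.
    assert (Hn1 : L + 1 <= INR n).
    { unfold L. rewrite <- S_INR. apply le_INR. lia. }
    assert (Hn2 : INR N1 <= INR n) by (apply le_INR; lia).
    unfold b. rewrite Rminus_0_r, Rabs_mult, pow_1_abs, Rmult_1_l, Rabs_pos_eq by (left; apply exp_pos).
    rewrite exp_Ropp.
    assert (0 <= L) by apply pos_INR.
    assert (Hq : INR n <= INR n * INR n - L * INR n) by nra.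
    pose proof (exp_ineq1_le (p * (INR n * INR n - L * INR n))) as Hexp.
    assert (Hpe : 0 < / (p * eps)) by (apply Rinv_0_lt_compat, Rmult_lt_0_compat; lra).
    assert (Hbig : / eps < p * INR n).
    { replace (/ eps) with (p * / (p * eps)) by (field; lra). apply Rmult_lt_compat_l; lra. }
    assert (0 < / eps) by now apply Rinv_0_lt_compat.
    rewrite <- (Rinv_inv eps). apply Rinv_lt_contravar.
    - apply Rmult_lt_0_compat; [lra|apply exp_pos].
    - nra. }
  assert (Hb1 : is_lim_seq (fun m => b (S m)) 0) by now apply is_lim_seq_incr_1 in Hlim.
  (* With odd [L = 2 N + 1], the [n]-th summand ([n >= 1]) is [b n - b (n + L)], so the series
     equals [b 1 + ... + b L]. Antisymmetry makes the sum from 0 to [L] vanish, leaving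
     [- b 0 = -1]. *)
  pose proof (is_series_window (fun m => b (S m)) (2 * N) Hb1) as HS.
  replace (sum_n (fun m => b (S m)) (2 * N)) with (-1) in HS.
  - eapply is_series_ext; [|exact HS]. intros n. cbv beta. unfold b, theta_coeff. fold p.
    replace (S (n + S (2 * N))) with ((2 * N + 1) + S n)%nat by lia.
    rewrite pow_add, Hodd, plus_INR. fold L. set (k := INR (S n)). unfold cosh.
    replace (- (p * (k * k - L * k))) with (- (p * (k * k)) + p * L * k) by ring.
    replace (- (p * ((L + k) * (L + k) - L * (L + k)))) with (- (p * (k * k)) + - (p * L * k)) by ring.
    rewrite !exp_plus. to_R. field.
  - rewrite sum_n_Reals.
    assert (Hz : sum_f_R0 b (2 * N + 1) = 0).
    { apply antisymmetric_sum. intros m Hm. unfold b.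
      rewrite minus_INR by exact Hm. fold L.
      replace (- (p * ((L - INR m) * (L - INR m) - L * (L - INR m))))
        with (- (p * (INR m * INR m - L * INR m))) by ring.
      assert (Hsg : (-1) ^ (2 * N + 1 - m) = - (-1) ^ m).
      { assert (Hm2 : (-1) ^ m * (-1) ^ m = 1).
        { rewrite <- Rpow_mult_distr. replace (-1 * -1) with 1 by ring. apply pow1. }
        assert (Hmm : (-1) ^ (2 * N + 1 - m) * (-1) ^ m = -1).
        { rewrite <- pow_add. now replace (2 * N + 1 - m + m)%nat with (2 * N + 1)%nat by lia. }
        transitivity ((-1) ^ (2 * N + 1 - m) * ((-1) ^ m * (-1) ^ m)); [rewrite Hm2; ring|].
        rewrite <- Rmult_assoc, Hmm. ring. }
      rewrite Hsg. ring. }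
    rewrite decomp_sum in Hz by lia.
    replace (pred (2 * N + 1)) with (2 * N)%nat in Hz by lia.
    replace (b 0%nat) with 1 in Hz; [lra|].
    unfold b. simpl. rewrite !Rmult_0_r, Rminus_diag, Rmult_0_r, Ropp_0, exp_0. ring.
Qed.

(** Raising [N] by one adds [2 cosh ((2 N + 1) p k) sinh (p k)] to the hyperbolic sine, where
    [p = PI c]. The last factor cancels [csch_coeff], and the increment is the series of
    [theta_cosh_series], worth [-1]. *)
Lemma theta_csch_series (c : R) (N : nat) : 0 < c ->
  is_series (fun n => csch_coeff c n * (theta_coeff c (S n) * sinh (2 * (PI * c) * INR N * INR (S n))))
    (- INR N).
Proof.
  intros Hc. induction N as [|N IH].
  - replace (- INR 0) with (0 * Series (fun n => 0)) by (simpl; ring).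
    eapply is_series_ext; [|apply is_series_Rscal, Series_correct].
    + intros n. cbv beta. replace (2 * (PI * c) * INR 0 * INR (S n)) with 0 by (simpl INR; ring).
      rewrite sinh_0. to_R. ring.
    + exists 0. apply (is_series_single (fun _ => 0) 0). reflexivity.
  - replace (- INR (S N)) with (- INR N + -1) by (rewrite S_INR; ring).
    eapply is_series_ext; [|exact (is_series_plus _ _ _ _ IH (theta_cosh_series c N Hc))].
    intros n. to_R. unfold csch_coeff.
    set (p := PI * c). rewrite plus_INR, mult_INR, (S_INR N). simpl (INR 2). simpl (INR 1).
    pose proof (INR_S_ge1 n) as Hk. set (k := INR (S n)) in *. set (x := INR N).
    pose proof PI_RGT_0.
    assert (Hs : 0 < sinh (p * k)).
    { apply sinh_pos. apply Rmult_lt_0_compat; [|lra]. apply Rmult_lt_0_compat; lra. }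
    assert (E : sinh (2 * p * (x + 1) * k) = sinh (2 * p * x * k)
        + 2 * cosh (p * ((1 + 1) * x + 1) * k) * sinh (p * k)).
    { unfold sinh, cosh.
      replace (2 * p * (x + 1) * k) with (p * ((1 + 1) * x + 1) * k + p * k) by ring.
      replace (2 * p * x * k) with (p * ((1 + 1) * x + 1) * k + - (p * k)) by ring.
      rewrite !Ropp_plus_distr, !exp_plus, Ropp_involutive. field. }
    rewrite E. field. lra.
Qed.

Lemma continuous_csch_series (c t : R) : 0 < c -> continuous (csch_series c) t.
Proof. intros Hc. apply continuous_sine_series. now apply ex_series_abs_csch_coeff. Qed.

Lemma theta_cos_abs_le (c t : R) : 0 < c ->
  Rabs (theta_cos c t) <= 1 + Series (fun n => Rabs (2 * theta_coeff c (S n))).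
Proof.
  intros Hc. unfold theta_cos. eapply Rle_trans; [apply Rabs_triang|]. rewrite Rabs_R1.
  apply Rplus_le_compat_l. eapply Rle_trans; [apply Series_Rabs|].
  - eapply ex_series_dominated; [|now apply (ex_series_abs_theta_coeff c)].
    intros n. rewrite Rabs_Rabsolu. apply cosine_series_abs_le.
  - apply Series_le; [|now apply ex_series_abs_theta_coeff].
    intros n. split; [apply Rabs_pos | apply cosine_series_abs_le].
Qed.

(** Only the csch series is expanded; the theta factor is kept whole and bounded uniformly. The
    integrated terms are those of [theta_csch_series] at [N = S k], up to a common factor. *)
Lemma theta_cos_csch_series_coeff (c : R) (k : nat) : 0 < c ->
  is_RInt (fun t => theta_cos c t * csch_series c t * sin (INR (S k) * t)) 0 PI
    (PI / 2 * (-2 * (INR (S k) * theta_coeff c (S k)))).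
Proof.
  intros Hc. pose proof PI_RGT_0.
  set (g := fun t => theta_cos c t * csch_series c t * sin (INR (S k) * t)).
  assert (Hg : forall x, continuous g x).
  { intros x. apply (continuous_mult (fun t => theta_cos c t * csch_series c t)); [|apply continuous_sin_lin].
    apply (continuous_mult (theta_cos c)); [now apply continuous_theta_cos | now apply continuous_csch_series]. }
  set (B := 1 + Series (fun n => Rabs (2 * theta_coeff c (S n)))).
  assert (Hs : is_series (fun n => csch_coeff c n *
     (PI * (theta_coeff c (S k) * theta_coeff c (S n) * sinh (2 * (PI * c) * INR (S k) * INR (S n)))))
     (RInt g 0 PI)).
  { apply (is_series_RInt
      (fun n t => csch_coeff c n * (theta_cos c t * (sin (INR (S n) * t) * sin (INR (S k) * t))))
      (fun n => B * csch_coeff c n) _ 0 PI).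
    - lra.
    - now apply ex_series_Rscal, ex_series_csch_coeff.
    - intros n t _. pose proof (csch_coeff_pos c n Hc).
      pose proof (theta_cos_abs_le c t Hc) as HB. fold B in HB.
      rewrite !Rabs_mult, (Rabs_pos_eq (csch_coeff c n)), (Rmult_comm B) by lra.
      apply Rmult_le_compat_l; [lra|].
      rewrite <- (Rmult_1_r B). apply Rmult_le_compat; try apply Rabs_pos; [|exact HB|].
      + apply Rmult_le_pos; apply Rabs_pos.
      + rewrite <- (Rmult_1_r 1).
        apply Rmult_le_compat; try apply Rabs_pos; apply Rabs_le, SIN_bound.
    - intros n. refine (is_RInt_scal (V := R_NormedModule) _ _ _ _ _ (theta_cos_sin_sin c (S n) (S k) Hc)).
    - eapply is_RInt_ext; [|apply is_RInt_cont, Hg]. intros t _. unfold g, csch_series.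
      rewrite (Rmult_comm (theta_cos c t)), Rmult_assoc, <- Series_scal_r.
      apply Series_ext. intros n. ring. }
  pose proof (is_series_Rscal (PI * theta_coeff c (S k)) _ _ (theta_csch_series c (S k) Hc)) as Hs2.
  replace (PI / 2 * (-2 * (INR (S k) * theta_coeff c (S k)))) with (RInt g 0 PI).
  { now apply is_RInt_cont. }
  rewrite <- (is_series_unique _ _ Hs).
  transitivity (PI * theta_coeff c (S k) * - INR (S k)); [|to_R; field].
  rewrite <- (is_series_unique _ _ Hs2). apply Series_ext. intros n. ring.
Qed.

(** Stated as a product because the nonvanishing of [theta_cos], which permits the division, is
    itself deduced from this equation. *)
Lemma theta_cos_ode (c t : R) : 0 < c -> theta_cos' c t = theta_cos c t * csch_series c t.
Proof.
  intros Hc. pose proof PI_RGT_0. symmetry. apply Rminus_diag_uniq.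
  apply (odd_periodic_zero (fun t => theta_cos c t * csch_series c t - theta_cos' c t) (2 * PI)); [lra| | |].
  - intros x. rewrite csch_series_opp. unfold theta_cos, theta_cos'.
    rewrite (Series_ext (fun n => 2 * theta_coeff c (S n) * cos (INR (S n) * - x))
       (fun n => 2 * theta_coeff c (S n) * cos (INR (S n) * x))).
    2:{ intros n. replace (INR (S n) * - x) with (- (INR (S n) * x)) by ring. now rewrite cos_neg. }
    rewrite (Series_ext (fun n => -2 * (INR (S n) * theta_coeff c (S n)) * sin (INR (S n) * - x))
       (fun n => - (-2 * (INR (S n) * theta_coeff c (S n)) * sin (INR (S n) * x)))).
    2:{ intros n. replace (INR (S n) * - x) with (- (INR (S n) * x)) by ring. rewrite sin_neg. ring. }
    rewrite Series_opp. ring.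
  - intros x. rewrite csch_series_period. unfold theta_cos, theta_cos'. f_equal; [f_equal; f_equal|].
    + apply Series_ext. intros n. now rewrite cos_INR_period.
    + apply Series_ext. intros n. now rewrite sin_INR_period.
  - intros x Hx. apply Rminus_diag_eq. unfold theta_cos'.
    apply (sine_series_representation (fun t => theta_cos c t * csch_series c t)
        (fun n => -2 * (INR (S n) * theta_coeff c (S n)))).
    + intros z. apply (continuous_mult (theta_cos c));
        [now apply continuous_theta_cos | now apply continuous_csch_series].
    + eapply ex_series_dominated; [|apply (ex_series_Rscal 2), (ex_series_theta_bound c)].
      intros n. cbv beta. rewrite Rabs_Rabsolu, Rabs_mult.
      replace (Rabs (-2)) with 2 by (rewrite Rabs_left; lra).
      apply Rmult_le_compat_l; [lra|]. now apply theta_coeff_abs_le.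
    + intros k. now apply theta_cos_csch_series_coeff.
    + lra.
Qed.

(* A zero would make [theta_cos] vanish identically by uniqueness for the linear differential equation
   [theta_cos_ode], but its mean value is 1. *)
Lemma theta_cos_neq_0 (c t : R) : 0 < c -> theta_cos c t <> 0.
Proof.
  intros Hc H0. pose proof PI_RGT_0.
  (* The integrating factor makes [E] constant, so one zero of [theta_cos] annihilates it
     everywhere. *)
  set (E := fun x => theta_cos c x * exp (- RInt (csch_series c) 0 x)).
  assert (HE : forall x, is_derive E x 0).
  { intros x.
    assert (HG : is_derive (fun x => RInt (csch_series c) 0 x) x (csch_series c x)).
    { apply (is_derive_RInt (V := R_NormedModule) _ _ 0).
      - exists (mkposreal 1 Rlt_0_1). intros y _. apply is_RInt_cont. intros z. now apply continuous_csch_series.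
      - now apply continuous_csch_series. }
    pose proof (is_derive_theta_cos c x Hc) as HT. rewrite theta_cos_ode in HT by exact Hc.
    unfold E. set (F := fun x => RInt (csch_series c) 0 x) in *.
    change (is_derive (fun x => theta_cos c x * exp (- F x)) x 0).
    auto_derive.
    - repeat split; eexists; [exact HT | exact HG].
    - replace (Derive (fun x0 : R => theta_cos c x0) x) with (theta_cos c x * csch_series c x)
        by (symmetry; apply is_derive_unique; exact HT).
      replace (Derive (fun x0 : R => F x0) x) with (csch_series c x)
        by (symmetry; apply is_derive_unique; exact HG).
      ring. }
  assert (Hconst : forall x y, x < y -> E x = E y).
  { intros x y Hxy. apply (eq_is_derive (V := R_NormedModule)); [|exact Hxy]. intros z _. apply HE. }
  assert (HEt : E t = 0) by (unfold E; rewrite H0; ring).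
  assert (Hall : forall x, theta_cos c x = 0).
  { intros x. assert (HEx : E x = 0).
    { destruct (Rtotal_order x t) as [Hlt|[->|Hgt]]; [|exact HEt|].
      - rewrite (Hconst x t Hlt). exact HEt.
      - rewrite <- (Hconst t x Hgt). exact HEt. }
    unfold E in HEx. apply Rmult_integral in HEx. destruct HEx as [HEx|HEx]; [exact HEx|].
    pose proof (exp_pos (- RInt (csch_series c) 0 x)). lra. }
  pose proof (theta_cos_coeff c 0 Hc) as HI. rewrite theta_coeff_0, Rmult_1_r in HI.
  apply (is_RInt_unique (V := R_CompleteNormedModule)) in HI.
  rewrite (RInt_ext _ (fun _ => 0)), RInt_const in HI.
  - unfold scal in HI; simpl in HI; unfold mult in HI; simpl in HI. lra.
  - intros x _. rewrite Hall. to_R. ring.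
Qed.

(** * The integral *)

Lemma is_RInt_odd_left (A : R -> R) (s l : R) : (forall x, A (- x) = - A x) ->
  is_RInt A 0 s l -> is_RInt A (- s) 0 (- l).
Proof.
  intros Hodd H. apply (is_RInt_swap (V := R_NormedModule)) in H.
  apply (is_RInt_ext (fun y => opp (A (- y)))).
  { intros x _. to_R. rewrite Hodd. ring. }
  apply (is_RInt_comp_opp (V := R_NormedModule) A). rewrite Ropp_involutive, Ropp_0. exact H.
Qed.

Lemma is_RInt_even_left (B : R -> R) (s l : R) : (forall x, B (- x) = B x) ->
  is_RInt B 0 s l -> is_RInt B (- s) 0 l.
Proof.
  intros Heven H. apply (is_RInt_opp (V := R_NormedModule)), (is_RInt_swap (V := R_NormedModule)) in H.
  apply (is_RInt_ext (fun y => opp ((fun z => opp (B z)) (- y)))).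
  { intros x _. to_R. rewrite Heven. ring. }
  apply (is_RInt_comp_opp (V := R_NormedModule) (fun z => opp (B z))).
  rewrite Ropp_involutive, Ropp_0, <- (Ropp_involutive l). exact H.
Qed.

Lemma RInt_exp_decay_le (A : R -> R) (M s t : R) : (forall x, continuous A x) ->
  (forall x, 0 <= x -> Rabs (A x) <= M * exp (- (PI * x))) -> 0 <= s <= t ->
  Rabs (RInt A s t) <= M * exp (- (PI * s)).
Proof.
  intros Hc HA Hst. pose proof PI2_1 as HPI.
  assert (HM : 0 <= M).
  { pose proof (HA 0 (Rle_refl 0)) as H. rewrite Rmult_0_r, Ropp_0, exp_0 in H.
    pose proof (Rabs_pos (A 0)). lra. }
  assert (HI : is_RInt (fun x => M * exp (- (PI * x))) s t
     (- (M / PI) * exp (- (PI * t)) - - (M / PI) * exp (- (PI * s)))).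
  { apply (is_RInt_derive (fun x => - (M / PI) * exp (- (PI * x)))).
    - intros x _. auto_derive; [exact I|]. field. lra.
    - intros x _. apply continuity_pt_filterlim. reg. }
  eapply Rle_trans.
  - refine (norm_RInt_le (V := R_NormedModule) A _ s t _ _ ltac:(lra) _ (is_RInt_cont A s t Hc) HI).
    intros x Hx. apply HA. lra.
  - pose proof (exp_pos (- (PI * t))). pose proof (exp_pos (- (PI * s))).
    assert (HMP : 0 <= M / PI) by (apply Rle_mult_inv_pos; lra).
    assert (M / PI <= M).
    { unfold Rdiv. rewrite <- (Rmult_1_r M) at 2. apply Rmult_le_compat_l; [exact HM|].
      assert (/ PI <= / 1) by (apply Rinv_le_contravar; lra). lra. }
    pose proof (Rmult_le_pos _ _ HMP (Rlt_le _ _ H)). nra.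
Qed.

(** The endpoints go to infinity independently, so the odd part does not cancel exactly: what is
    left is its integral between [- a] and [b], small by decay. The even part contributes the
    half-line limit [L] from each side. *)
Lemma is_RInt_gen_odd_even (g : R -> Complex.C) (A B : R -> R) (L M : R) :
  (forall x, continuous A x) -> (forall x, continuous B x) -> (forall x, g x = (A x, B x)) ->
  (forall x, A (- x) = - A x) -> (forall x, B (- x) = B x) ->
  (forall x, 0 <= x -> Rabs (A x) <= M * exp (- (PI * x))) ->
  (forall x, 1 <= x -> Rabs (RInt B 0 x - L) <= M * exp (- (PI * x))) ->
  is_RInt_gen (V := C_R_NormedModule) g (Rbar_locally m_infty) (Rbar_locally p_infty) (0, 2 * L).
Proof.
  intros HAc HBc Hg HAo HBe HA HB P [eps HP]. pose proof (cond_pos eps) as He. pose proof PI2_1 as HPI.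
  assert (HM : 0 <= M).
  { pose proof (HA 0 (Rle_refl 0)) as H. rewrite Rmult_0_r, Ropp_0, exp_0 in H.
    pose proof (Rabs_pos (A 0)). lra. }
  (* Chosen so that [exp (PI x) >= 1 + PI x > 2 M / eps] beyond [T]. *)
  set (T := 1 + 2 * M / eps).
  assert (HMe : 0 <= 2 * M / eps) by (apply Rle_mult_inv_pos; lra).
  assert (Hsmall : forall x, T <= x -> M * exp (- (PI * x)) < eps / 2).
  { intros x Hx. pose proof (exp_ineq1_le (PI * x)).
    assert (Hex : 1 + 2 * M / eps < exp (PI * x)) by (unfold T in Hx; nra).
    rewrite exp_Ropp. apply Rmult_lt_reg_r with (exp (PI * x)); [apply exp_pos|].
    rewrite Rmult_assoc, Rinv_l, Rmult_1_r by (apply Rgt_not_eq, exp_pos).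
    apply Rle_lt_trans with (eps / 2 * (2 * M / eps)); [right; field; lra|].
    apply Rmult_lt_compat_l; lra. }
  apply (Filter_prod _ _ _ (fun a => a < - T) (fun b => T < b)).
  { exists (- T). auto. }
  { exists T. auto. }
  intros a b Ha Hb.
  assert (H1 : is_RInt A a b (- RInt A 0 (- a) + RInt A 0 b)).
  { refine (is_RInt_Chasles (V := R_NormedModule) A a 0 b _ _ _ (is_RInt_cont A 0 b HAc)).
    rewrite <- (Ropp_involutive a) at 1. apply is_RInt_odd_left; [exact HAo | now apply is_RInt_cont]. }
  assert (H2 : is_RInt B a b (RInt B 0 (- a) + RInt B 0 b)).
  { refine (is_RInt_Chasles (V := R_NormedModule) B a 0 b _ _ _ (is_RInt_cont B 0 b HBc)).
    rewrite <- (Ropp_involutive a) at 1. apply is_RInt_even_left; [exact HBe | now apply is_RInt_cont]. }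
  exists (- RInt A 0 (- a) + RInt A 0 b, RInt B 0 (- a) + RInt B 0 b). split.
  - apply (is_RInt_ext (V := C_R_NormedModule) (fun x => (A x, B x))).
    { intros x _. symmetry. apply Hg. }
    apply (is_RInt_fct_extend_pair (U := R_NormedModule) (V := R_NormedModule)); assumption.
  - apply HP. split.
    + change (Rabs (- RInt A 0 (- a) + RInt A 0 b - 0) < eps). rewrite Rminus_0_r.
      assert (Hst : forall s t, T < s -> s <= t -> Rabs (RInt A 0 t - RInt A 0 s) < eps).
      { intros s t Hs Ht.
        replace (RInt A 0 t - RInt A 0 s) with (RInt A s t).
        - eapply Rle_lt_trans; [apply (RInt_exp_decay_le A M); auto; unfold T in *; lra|].
          specialize (Hsmall s ltac:(lra)). lra.
        - rewrite <- (RInt_Chasles (V := R_CompleteNormedModule) A 0 s t); try now apply ex_RInt_cont.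
          to_R. symmetry. ring. }
      destruct (Rle_lt_dec (- a) b).
      * replace (- RInt A 0 (- a) + RInt A 0 b) with (RInt A 0 b - RInt A 0 (- a)) by ring.
        apply Hst; lra.
      * rewrite <- Rabs_Ropp.
        replace (- (- RInt A 0 (- a) + RInt A 0 b)) with (RInt A 0 (- a) - RInt A 0 b) by ring.
        apply Hst; lra.
    + change (Rabs (RInt B 0 (- a) + RInt B 0 b - 2 * L) < eps).
      replace (RInt B 0 (- a) + RInt B 0 b - 2 * L) with ((RInt B 0 (- a) - L) + (RInt B 0 b - L)) by ring.
      eapply Rle_lt_trans; [apply Rabs_triang|].
      pose proof (HB (- a) ltac:(unfold T in *; lra)). pose proof (HB b ltac:(unfold T in *; lra)).
      pose proof (Hsmall (- a) ltac:(lra)). pose proof (Hsmall b ltac:(lra)). lra.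
Qed.

Lemma continuous_sech (x : R) : continuous (fun x => / cosh (PI * x)) x.
Proof.
  apply (continuous_ext (fermi PI)); [intros; apply fermi_PI | apply continuous_fermi].
Qed.

Lemma sech_cos_close_difference (c y B : R) (n : nat) : 1 <= B ->
  Rabs ((RInt (fun x => / cosh (PI * x) * cos (2 * PI * (c * INR (S n) - y) * x)) 0 B
         - RInt (fun x => / cosh (PI * x) * cos (2 * PI * (c * INR (S n) + y) * x)) 0 B)
        - (/ (2 * cosh (PI * (c * INR (S n) - y))) - / (2 * cosh (PI * (c * INR (S n) + y)))))
  <= 16 * exp (- (PI * B)).
Proof.
  intros HB.
  pose proof (sech_cos_integral_close (c * INR (S n) - y) B HB) as H1.
  pose proof (sech_cos_integral_close (c * INR (S n) + y) B HB) as H2.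
  revert H1 H2. unfold Rabs; repeat destruct Rcase_abs; lra.
Qed.

(** Write [u = PI c m] with [m = S n], and [v = PI y]. Then [cosh (u + v) - cosh (u - v) = 2 sinh u
    sinh v], so the [1 / sinh u] cancels. What remains is [tanh (u + v) - tanh (u - v)] divided by
    [2 cosh v]. The proof checks this as a rational identity in [exp v] and [exp u]. *)
Lemma csch_sech_difference (c y : R) (n : nat) : 0 < c ->
  csch_coeff c n * (/ (2 * cosh (PI * (c * INR (S n) - y))) - / (2 * cosh (PI * (c * INR (S n) + y))))
  = / (2 * cosh (PI * y)) * kappa_term c y n.
Proof.
  intros Hc. unfold csch_coeff, kappa_term, fermi, sinh, cosh.
  pose proof (INR_S_ge1 n) as Hk. set (k := INR (S n)) in *. pose proof PI_RGT_0.
  set (a := exp (PI * y)). set (b := exp (PI * c * k)).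
  assert (Ha : 0 < a) by apply exp_pos.
  assert (Hb : 1 < b).
  { unfold b. rewrite <- exp_0. apply exp_increasing.
    apply Rmult_lt_0_compat; [apply Rmult_lt_0_compat|]; lra. }
  replace (- (PI * (c * k - y))) with (PI * y + - (PI * c * k)) by ring.
  replace (PI * (c * k - y)) with (PI * c * k + - (PI * y)) by ring.
  replace (- (PI * (c * k + y))) with (- (PI * c * k) + - (PI * y)) by ring.
  replace (PI * (c * k + y)) with (PI * c * k + PI * y) by ring.
  replace (- (2 * PI * (c * k - y))) with ((PI * y + PI * y) + (- (PI * c * k) + - (PI * c * k))) by ring.
  replace (- (2 * PI * (c * k + y))) with ((- (PI * y) + - (PI * y)) + (- (PI * c * k) + - (PI * c * k))) by ring.
  rewrite !exp_plus, !exp_Ropp. fold a b.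
  assert (0 < a * a) by nra. assert (1 < b * b) by nra.
  assert (0 < a * a * (b * b)) by (apply Rmult_lt_0_compat; lra).
  field. repeat split; lra.
Qed.

(** Product-to-sum turns each term into a difference of two cosine transforms of [1 / cosh]. Each is
    off by at most [8 * exp (- (PI * B))] whatever [n] is, so the total error is bounded through the
    sum of the [csch_coeff]. *)
Lemma frak_sin_integral_close (c y B : R) : 0 < c -> 1 <= B ->
  Rabs (RInt (fun x => 2 * csch_series c (2 * PI * c * x) / cosh (PI * x) * sin (2 * PI * x * y)) 0 B
        - / (2 * cosh (PI * y)) * Series (kappa_term c y))
  <= 16 * Series (csch_coeff c) * exp (- (PI * B)).
Proof.
  intros Hc HB. pose proof PI_RGT_0.
  set (g := fun x => 2 * csch_series c (2 * PI * c * x) / cosh (PI * x) * sin (2 * PI * x * y)).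
  set (E := (fun xi => RInt (fun x => / cosh (PI * x) * cos (2 * PI * xi * x)) 0 B) : R -> R).
  assert (Hsc : forall xi x, continuous (fun x => / cosh (PI * x) * cos (2 * PI * xi * x)) x).
  { intros xi x. apply (continuous_mult (fun x => / cosh (PI * x))); [apply continuous_sech | apply continuous_cos_lin]. }
  assert (HE : forall xi, is_RInt (fun x => / cosh (PI * x) * cos (2 * PI * xi * x)) 0 B (E xi)).
  { intros xi. apply is_RInt_cont, Hsc. }
  assert (Hgc : forall x, continuous g x).
  { intros x. apply (continuous_mult (fun x => 2 * csch_series c (2 * PI * c * x) / cosh (PI * x))).
    - apply (continuous_mult (fun x => 2 * csch_series c (2 * PI * c * x))); [|apply continuous_sech].
      apply (continuous_mult (fun _ => 2)); [apply continuous_const|].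
      apply (continuous_comp (fun x => 2 * PI * c * x) (csch_series c)); [|now apply continuous_csch_series].
      apply continuity_pt_filterlim. reg.
    - apply continuity_pt_filterlim. reg. }
  assert (Hcosh : forall x, 0 < / cosh (PI * x) <= 1).
  { intros x. pose proof (cosh_pos (PI * x)). split; [now apply Rinv_0_lt_compat|].
    replace 1 with (/ 1) by apply Rinv_1. apply Rinv_le_contravar; [lra|]. unfold cosh.
    pose proof (exp_pos (PI * x)). rewrite exp_Ropp. set (u := exp (PI * x)) in *.
    assert (0 <= (u - 1) * (u - 1) * / u) by (apply Rmult_le_pos; [apply Rle_0_sqr | left; now apply Rinv_0_lt_compat]).
    replace ((u - 1) * (u - 1) * / u) with (u + / u - 2) in H2 by (field; lra). lra. }
  assert (HS : is_series (fun n => csch_coeff c n * (E (c * INR (S n) - y) - E (c * INR (S n) + y))) (RInt g 0 B)).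
  { apply (is_series_RInt (fun n x => csch_coeff c n * (/ cosh (PI * x) * cos (2 * PI * (c * INR (S n) - y) * x)
        - / cosh (PI * x) * cos (2 * PI * (c * INR (S n) + y) * x))) (fun n => 2 * csch_coeff c n) _ 0 B).
    - lra.
    - now apply ex_series_Rscal, ex_series_csch_coeff.
    - intros n x _. pose proof (csch_coeff_pos c n Hc).
      rewrite Rabs_mult, (Rabs_pos_eq (csch_coeff c n)), (Rmult_comm 2 (csch_coeff c n)) by lra.
      apply Rmult_le_compat_l; [lra|]. rewrite <- Rmult_minus_distr_l, Rabs_mult.
      pose proof (Hcosh x). rewrite (Rabs_pos_eq (/ cosh (PI * x))) by lra.
      pose proof (COS_bound (2 * PI * (c * INR (S n) - y) * x)).
      pose proof (COS_bound (2 * PI * (c * INR (S n) + y) * x)).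
      assert (Hd : Rabs (cos (2 * PI * (c * INR (S n) - y) * x) - cos (2 * PI * (c * INR (S n) + y) * x)) <= 2)
        by (apply Rabs_le; lra).
      apply Rle_trans with (1 * 2); [|lra].
      apply Rmult_le_compat; [lra|apply Rabs_pos|lra|exact Hd].
    - intros n. refine (is_RInt_scal (V := R_NormedModule) _ _ _ _ _ _).
      exact (is_RInt_minus _ _ _ _ _ _ (HE (c * INR (S n) - y)) (HE (c * INR (S n) + y))).
    - eapply is_RInt_ext; [|apply is_RInt_cont, Hgc]. intros x _. unfold g, csch_series.
      unfold Rdiv. rewrite <- Series_scal_l, <- !Series_scal_r. apply Series_ext. intros n.
      replace (2 * PI * (c * INR (S n) - y) * x) with (INR (S n) * (2 * PI * c * x) - 2 * PI * x * y) by ring.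
      replace (2 * PI * (c * INR (S n) + y) * x) with (INR (S n) * (2 * PI * c * x) + 2 * PI * x * y) by ring.
      rewrite cos_minus, cos_plus. ring. }
  pose proof (is_series_Rscal (/ (2 * cosh (PI * y))) _ _ (Series_correct _ (ex_series_kappa_term c y Hc))) as HK.
  pose proof (is_series_minus _ _ _ _ HS HK) as HD.
  change (is_series (fun n => csch_coeff c n * (E (c * INR (S n) - y) - E (c * INR (S n) + y))
     - / (2 * cosh (PI * y)) * kappa_term c y n)
     (RInt g 0 B - / (2 * cosh (PI * y)) * Series (kappa_term c y))) in HD.
  change (Rabs (RInt g 0 B - / (2 * cosh (PI * y)) * Series (kappa_term c y))
    <= 16 * Series (csch_coeff c) * exp (- (PI * B))).
  rewrite <- (is_series_unique _ _ HD).
  assert (Hb : forall n, Rabs (csch_coeff c n * (E (c * INR (S n) - y) - E (c * INR (S n) + y))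
       - / (2 * cosh (PI * y)) * kappa_term c y n) <= 16 * exp (- (PI * B)) * csch_coeff c n).
  { intros n. rewrite <- csch_sech_difference, <- Rmult_minus_distr_l by exact Hc.
    pose proof (csch_coeff_pos c n Hc).
    rewrite Rabs_mult, (Rabs_pos_eq (csch_coeff c n)), Rmult_comm by lra.
    apply Rmult_le_compat_r; [lra|]. now apply sech_cos_close_difference. }
  replace (16 * Series (csch_coeff c) * exp (- (PI * B)))
    with (Series (fun n => 16 * exp (- (PI * B)) * csch_coeff c n)) by (rewrite Series_scal_l; ring).
  assert (Hex : ex_series (fun n => 16 * exp (- (PI * B)) * csch_coeff c n))
    by now apply ex_series_Rscal, ex_series_csch_coeff.
  eapply Rle_trans; [apply Series_Rabs|].
  - eapply ex_series_dominated; [|exact Hex]. intros n. rewrite Rabs_Rabsolu. apply Hb.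
  - apply Series_le; [|exact Hex]. intros n. split; [apply Rabs_pos | apply Hb].
Qed.

(** * Reduction of the complex statement to real functions *)

Lemma Cexp_RtoC (x : R) : Cexp (RtoC x) = RtoC (exp x).
Proof.
  unfold Cexp, RtoC. simpl. rewrite cos_0, sin_0, Rmult_1_r, Rmult_0_r. reflexivity.
Qed.

Lemma Cexp_imaginary (x : R) : Cexp (0, x) = (cos x, sin x).
Proof. unfold Cexp. simpl. now rewrite exp_0, !Rmult_1_l. Qed.

Lemma Ccos_RtoC (x : R) : Ccos (RtoC x) = RtoC (cos x).
Proof.
  unfold Ccos.
  replace (Ci * RtoC x)%C with ((0, x) : Complex.C) by (apply injective_projections; simpl; ring).
  replace (- (0, x))%C with ((0, - x) : Complex.C) by (apply injective_projections; simpl; ring).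
  rewrite !Cexp_imaginary, cos_neg, sin_neg.
  apply injective_projections; simpl; field.
Qed.

Lemma CSeries_RtoC (a : nat -> Complex.C) (r : nat -> R) :
  (forall n, a n = RtoC (r n)) -> CSeries a = RtoC (Series r).
Proof.
  intros H. unfold CSeries, RtoC. f_equal.
  - apply Series_ext. intros n. now rewrite H.
  - rewrite (Series_ext _ (fun n => 0 * 0)).
    + rewrite Series_scal_l. ring.
    + intros n. rewrite H. simpl. ring.
Qed.

Lemma theta4_real (c t : R) : theta4 (RtoC t) (Ci * RtoC c)%C = RtoC (theta_cos c (2 * t)).
Proof.
  unfold theta4, theta_cos.
  rewrite (CSeries_RtoC _ (fun n => theta_coeff c (S n) * cos (INR (S n) * (2 * t)))).
  - rewrite RtoC_plus, <- RtoC_mult. do 2 f_equal. rewrite <- Series_scal_l.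
    apply Series_ext. intros n. ring.
  - intros n. cbv zeta.
    replace (RtoC PI * Ci * (Ci * RtoC c) * RtoC (INR (S n) ^ 2))%C
      with (RtoC (- (PI * c * (INR (S n) * INR (S n))))).
    2:{ set (k := INR (S n)). apply injective_projections; simpl; ring. }
    replace (2 * RtoC (INR (S n)) * RtoC t)%C with (RtoC (INR (S n) * (2 * t))).
    2:{ set (k := INR (S n)). apply injective_projections; simpl; ring. }
    rewrite Cexp_RtoC, Ccos_RtoC, <- !RtoC_mult. reflexivity.
Qed.

Lemma is_lim_difference_quotient (f : R -> R) (t l : R) :
  is_derive f t l -> is_lim (fun x => (f x - f t) / (x - t)) t l.
Proof.
  intros H. apply is_derive_Reals in H. apply is_lim_spec. intros eps.
  destruct (H eps (cond_pos eps)) as [d Hd]. exists d. intros x Hx Hne.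
  specialize (Hd (x - t) ltac:(lra) Hx). now rewrite Rplus_minus in Hd.
Qed.

(** [C_derive] takes its limit along the horizontal line through the point; at a real point this
    line is the real axis, where the difference quotients are real. *)
Lemma C_derive_real (f : Complex.C -> Complex.C) (g : R -> R) (t l : R) :
  (forall x, f (RtoC x) = RtoC (g x)) -> is_derive g t l -> C_derive f (RtoC t) = RtoC l.
Proof.
  intros Hf Hg.
  assert (Hq : forall x, x <> t ->
     ((f (RtoC x) - f (RtoC t)) / (RtoC x - RtoC t))%C = RtoC ((g x - g t) / (x - t))).
  { intros x Hx. rewrite !Hf, RtoC_div, !RtoC_minus by lra. reflexivity. }
  unfold C_derive, C_lim. change (snd (RtoC t)) with 0. change (fst (RtoC t)) with t.
  change (RtoC l) with ((l, 0) : Complex.C). apply (f_equal2 pair).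
  - rewrite (Lim_ext_loc (fun x => (g x - g t) / (x - t))).
    + now rewrite (is_lim_unique _ _ _ (is_lim_difference_quotient g t l Hg)).
    + exists (mkposreal 1 Rlt_0_1). intros x _ Hx.
      change ((x, 0) : Complex.C) with (RtoC x). now rewrite Hq.
  - rewrite (Lim_ext_loc (fun _ => 0)).
    + now rewrite Lim_const.
    + exists (mkposreal 1 Rlt_0_1). intros x _ Hx.
      change ((x, 0) : Complex.C) with (RtoC x). now rewrite Hq.
Qed.

Lemma theta4'_real (c t : R) : 0 < c ->
  theta4' (RtoC t) (Ci * RtoC c)%C = RtoC (2 * theta_cos' c (2 * t)).
Proof.
  intros Hc. unfold theta4'. apply (C_derive_real _ (fun x => theta_cos c (2 * x))).
  - intros x. apply theta4_real.
  - apply (is_derive_comp (V := R_NormedModule) (theta_cos c) (fun x => 2 * x) t).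
    + now apply is_derive_theta_cos.
    + auto_derive; [exact I|ring].
Qed.

(** Applied to [k] and to its complement, this gives [c > 0], so [tau] lies on the positive
    imaginary axis. *)
Lemma ellipticK_pos (k : R) : 0 < k < 1 -> 0 < ellipticK k.
Proof.
  intros Hk. pose proof PI_RGT_0.
  assert (Hpos : forall t, 0 < 1 - k ^ 2 * sin t ^ 2).
  { intros t. pose proof (SIN_bound t). assert (0 <= sin t ^ 2 <= 1) by (split; nra).
    assert (0 < k ^ 2 < 1) by (split; nra). nra. }
  apply RInt_gt_0; [lra| |].
  - intros t _. apply Rinv_0_lt_compat, sqrt_lt_R0, Hpos.
  - intros t _. apply (ex_derive_continuous (V := R_NormedModule)). auto_derive.
    repeat split; [apply Hpos|]. apply Rgt_not_eq, sqrt_lt_R0, Hpos.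
Qed.

Lemma compl_modulus_bounds (k : R) : 0 < k < 1 -> 0 < compl_modulus k < 1.
Proof.
  intros Hk. unfold compl_modulus. assert (0 < 1 - k ^ 2 < 1) by (split; nra). split.
  - apply sqrt_lt_R0. lra.
  - apply Rlt_le_trans with (sqrt 1); [apply sqrt_lt_1; lra | rewrite sqrt_1; lra].
Qed.

Lemma compl_modulus_involutive (k : R) : 0 < k < 1 -> compl_modulus (compl_modulus k) = k.
Proof.
  intros Hk. unfold compl_modulus. rewrite pow2_sqrt by nra.
  replace (1 - (1 - k ^ 2)) with (k ^ 2) by ring. apply sqrt_pow2. lra.
Qed.

(** With [tau = i c] the argument [- i PI tau x] is the real number [PI c x]. The factor 2 comes
    from the doubled variable of [theta_cos]. *)
Lemma frakf_real (x k : R) : 0 < k < 1 ->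
  frakf x k = RtoC (2 * csch_series (ellipticK' k / ellipticK k)
                        (2 * PI * (ellipticK' k / ellipticK k) * x)).
Proof.
  intros Hk. pose proof (ellipticK_pos k Hk) as HK.
  pose proof (ellipticK_pos _ (compl_modulus_bounds k Hk)) as HK'. fold (ellipticK' k) in HK'.
  unfold frakf. cbv zeta.
  assert (Htau : tau k = (Ci * RtoC (ellipticK' k / ellipticK k))%C).
  { unfold tau. rewrite RtoC_div by lra. unfold Cdiv. ring. }
  rewrite Htau. set (c := ellipticK' k / ellipticK k).
  assert (Hc : 0 < c) by now apply Rdiv_lt_0_compat.
  replace (- Ci * RtoC PI * (Ci * RtoC c) * RtoC x)%C with (RtoC (PI * c * x))
    by (apply injective_projections; simpl; ring).
  rewrite theta4_real, theta4'_real by exact Hc. rewrite theta_cos_ode by exact Hc.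
  pose proof (theta_cos_neq_0 c (2 * (PI * c * x)) Hc).
  rewrite <- RtoC_div by assumption. f_equal.
  replace (2 * PI * c * x) with (2 * (PI * c * x)) by ring. now field.
Qed.

Theorem mainTheorem3 (k : R) (hk0 : 0 < k) (hk1 : k < 1) (y : R) :
  is_RInt_gen (V := C_R_NormedModule)
    (fun x : R =>
       (frakf x k / RtoC (cosh (PI * x)) * Cexp (2 * PI * Ci * x * y))%C)
    (Rbar_locally m_infty) (Rbar_locally p_infty)
    (Ci * RtoC (ellipticK k) / RtoC (ellipticK' k)
     * (1 / RtoC (cosh (PI * y)))
     * (frakf y (compl_modulus k) + 2 * y
        - RtoC (ellipticK' k) / RtoC (ellipticK k)
          * RtoC (tanh (PI * y))))%C.
Proof.
  assert (Hk : 0 < k < 1) by lra.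
  pose proof (compl_modulus_bounds k Hk) as Hk'.
  pose proof (ellipticK_pos k Hk) as HK. pose proof (ellipticK_pos _ Hk') as HK'.
  fold (ellipticK' k) in HK'. pose proof PI_RGT_0 as HPI.
  set (c := ellipticK' k / ellipticK k).
  assert (Hc : 0 < c) by now apply Rdiv_lt_0_compat.
  assert (Hc' : ellipticK k / ellipticK' k = / c) by (unfold c; field; lra).
  assert (Hfy : frakf y (compl_modulus k) = RtoC (2 * csch_series (/ c) (2 * PI / c * y))).
  (* Complementing twice returns [k], so the complementary modulus swaps [K] and [K'] and inverts
     [c]. *)
  { rewrite frakf_real by exact Hk'. unfold ellipticK'. rewrite compl_modulus_involutive by exact Hk.
    fold (ellipticK' k). rewrite Hc'. reflexivity. }
  rewrite Hfy, <- tanh_comb_fourier by exact Hc.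
  set (u := fun x => 2 * csch_series c (2 * PI * c * x) / cosh (PI * x)).
  assert (Huc : forall x, continuous u x).
  { intros x. apply (continuous_mult (fun x => 2 * csch_series c (2 * PI * c * x))); [|apply continuous_sech].
    apply (continuous_mult (fun _ => 2)); [apply continuous_const|].
    apply (continuous_comp (fun x => 2 * PI * c * x) (csch_series c)); [|now apply continuous_csch_series].
    apply continuity_pt_filterlim. reg. }
  assert (Huo : forall x, u (- x) = - u x).
  { intros x. unfold u. replace (2 * PI * c * - x) with (- (2 * PI * c * x)) by ring.
    replace (PI * - x) with (- (PI * x)) by ring. rewrite csch_series_opp, cosh_opp. unfold Rdiv. ring. }
  assert (Hub : forall x, Rabs (u x) <= 4 * Series (csch_coeff c) * exp (- (PI * x))).
  { intros x.
    assert (Hs : Rabs (csch_series c (2 * PI * c * x)) <= Series (csch_coeff c)).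
    { unfold csch_series. eapply Rle_trans; [apply Series_Rabs|].
      - eapply ex_series_dominated; [|exact (ex_series_abs_csch_coeff c Hc)].
        intros n. rewrite Rabs_Rabsolu. apply sine_series_abs_le.
      - apply Series_le; [|now apply ex_series_csch_coeff]. intros n. split; [apply Rabs_pos|].
        eapply Rle_trans; [apply sine_series_abs_le|].
        rewrite Rabs_pos_eq; [apply Rle_refl | left; now apply csch_coeff_pos]. }
    assert (Hch : 0 < / cosh (PI * x) <= 2 * exp (- (PI * x))).
    { pose proof (cosh_pos (PI * x)). split; [now apply Rinv_0_lt_compat|].
      rewrite exp_Ropp. replace (2 * / exp (PI * x)) with (/ (exp (PI * x) / 2)).
      - pose proof (exp_pos (PI * x)). pose proof (exp_pos (- (PI * x))).
        apply Rinv_le_contravar; [lra|]. unfold cosh. lra.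
      - field. apply Rgt_not_eq, exp_pos. }
    unfold u, Rdiv. rewrite !Rabs_mult, (Rabs_pos_eq 2), (Rabs_pos_eq (/ _)) by lra.
    replace (4 * Series (csch_coeff c) * exp (- (PI * x)))
      with ((2 * Series (csch_coeff c)) * (2 * exp (- (PI * x)))) by ring.
    pose proof (Rabs_pos (csch_series c (2 * PI * c * x))).
    apply Rmult_le_compat; lra. }
  assert (HG : 0 <= Series (csch_coeff c)).
  { replace 0 with (0 * Series (csch_coeff c)) by ring. rewrite <- Series_scal_l.
    apply Series_le; [|now apply ex_series_csch_coeff]. intros n.
    pose proof (csch_coeff_pos c n Hc). lra. }
  (* Since [1 - kappa y = tanh (PI y)], the terms [2 y] and [c tanh (PI y)] undo the line and the
     [n = 0] term of [tanh_comb]. What is left is [c] times the series, and this [c] cancels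
     [K / K']. The value is arranged as twice a half-line integral. *)
  replace (Ci * RtoC (ellipticK k) / RtoC (ellipticK' k) * (1 / RtoC (cosh (PI * y)))
     * (RtoC (tanh_comb c y) + 2 * RtoC y - RtoC (ellipticK' k) / RtoC (ellipticK k) * RtoC (tanh (PI * y))))%C
    with ((0, 2 * (/ (2 * cosh (PI * y)) * Series (kappa_term c y))) : Complex.C).
  2:{ pose proof (cosh_pos (PI * y)).
      replace (Ci * RtoC (ellipticK k) / RtoC (ellipticK' k))%C with (Ci * RtoC (/ c))%C
        by (rewrite <- Hc', RtoC_div by lra; unfold Cdiv; ring).
      rewrite <- !RtoC_div by lra. fold c. rewrite <- !RtoC_mult, <- RtoC_plus, <- RtoC_minus.
      unfold tanh_comb. rewrite fermi_2PI.
      apply injective_projections; simpl; field; lra. }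
  (* The constant 16 is the one of [frak_sin_integral_close]; it also covers the pointwise bound
     [Hub], whose constant is 4. *)
  apply (is_RInt_gen_odd_even _ (fun x => u x * cos (2 * PI * x * y)) (fun x => u x * sin (2 * PI * x * y))
     _ (16 * Series (csch_coeff c))).
  - intros x. apply (continuous_mult u); [apply Huc|]. apply continuity_pt_filterlim. reg.
  - intros x. apply (continuous_mult u); [apply Huc|]. apply continuity_pt_filterlim. reg.
  - intros x. rewrite frakf_real by exact Hk. fold c. pose proof (cosh_pos (PI * x)).
    rewrite <- RtoC_div by lra.
    replace (2 * RtoC PI * Ci * RtoC x * RtoC y)%C with ((0, 2 * PI * x * y) : Complex.C)
      by (apply injective_projections; simpl; ring).
    rewrite Cexp_imaginary. unfold u. apply injective_projections; simpl; ring.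
  - intros x. rewrite Huo. replace (2 * PI * - x * y) with (- (2 * PI * x * y)) by ring.
    rewrite cos_neg. ring.
  - intros x. rewrite Huo. replace (2 * PI * - x * y) with (- (2 * PI * x * y)) by ring.
    rewrite sin_neg. ring.
  - intros x _. rewrite Rabs_mult.
    assert (Rabs (cos (2 * PI * x * y)) <= 1) by apply Rabs_le, COS_bound.
    specialize (Hub x). pose proof (Rabs_pos (u x)). pose proof (exp_pos (- (PI * x))).
    assert (0 <= Series (csch_coeff c) * exp (- (PI * x))) by (apply Rmult_le_pos; lra).
    apply Rle_trans with (Rabs (u x) * 1); [apply Rmult_le_compat_l; lra | lra].
  - intros x Hx. now apply frak_sin_integral_close.
Qed.
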